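(* Let $\mathcal{A}$ be a cellular tower category. Suppose that for all $n\in\mathbb{N}$ and all pairs of indices $\lambda\in\Lambda_n\setminus\Lambda_{n-2}$ and $\mu\in\Lambda_n\setminus\Lambda_{n-4}$ we have $$\mathrm{Ext}^1_{A_n}(\Delta_n(\lambda),\Delta_n(\mu))=0.$$ Then each of the endomorphism algebras $A_n$ ($n\in\mathbb{N}$) in $\mathcal{A}$ is semi-simple.
   Context: **Conventions.** $K$ is a field. All algebras are finite-dimensional $K$-algebras and all modules are finitely generated unitary left modules unless stated otherwise; $A\text{-mod}$ is the category of $A$-modules. $\mathcal{A}$ is a small $K$-linear category with finite-dimensional Hom-spaces and bilinear composition. Morphisms are composed from left to right: for $a\in\mathrm{Hom}_{\mathcal{A}}(p,m)$ and $b\in\mathrm{Hom}_{\mathcal{A}}(m,n)$ the composite is $ab\in\mathrm{Hom}_{\mathcal{A}}(p,n)$. Write $A_n=\mathrm{End}_{\mathcal{A}}(n)$; thus $\mathrm{Hom}_{\mathcal{A}}(m,n)$ is an $A_m$-$A_n$-bimodule. $\mathbb{N}$ contains $0$. **Cellular category.** $\mathcal{A}$ is cellular if it has a $K$-linear contravariant functor $*$, identity on objects, with $(-)^{**}=\mathrm{id}_{\mathcal{A}}$, a partially ordered set $\Lambda$, a finite set $M(n,\lambda)$ for each object $n$ and $\lambda\in\Lambda$, and for all objects $m,n$ and $\lambda\in\Lambda$ an injection $M(m,\lambda)\times M(n,\lambda)\to\mathrm{Hom}_{\mathcal{A}}(m,n)$, $(S,T)\mapsto C^\lambda_{S,T}$,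 such that: (C1) for all $m,n$ the induced map $\coprod_{\lambda\in\Lambda}M(m,\lambda)\times M(n,\lambda)\to\mathrm{Hom}_{\mathcal{A}}(m,n)$ is injective with image a $K$-basis; (C2) $(C^\lambda_{S,T})^*=C^\lambda_{T,S}$; (C3) for all objects $p,m,n$, all $\lambda\in\Lambda$, $a\in\mathrm{Hom}_{\mathcal{A}}(p,m)$, $S\in M(m,\lambda)$, $T\in M(n,\lambda)$, $$aC^\lambda_{S,T}\equiv\sum_{S'\in M(p,\lambda)}r_a(S',S)\,C^\lambda_{S',T}\pmod{\mathcal{A}(<\lambda)},$$ where $r_a(S',S)\in K$ is independent of $T$ and $\mathcal{A}(<\lambda)$ is the $K$-span of $\{C^\mu_{S,T}\mid\mu<\lambda,\ S\in M(p,\mu),\ T\in M(n,\mu)\}$. Put $\Lambda_n=\{\lambda\in\Lambda\mid M(n,\lambda)\neq\emptyset\}$ with the induced order, and $\Lambda_k=\emptyset$ for $k<0$. For $\lambda\in\Lambda_n$ the **cell module** $\Delta_n(\lambda)$ is the left $A_n$-module with $K$-basis $\{C^{(n,\lambda)}_X\mid X\in M(n,\lambda)\}$ and action $aC^{(n,\lambda)}_X=\sum_{Y\in M(n,\lambda)}r_a(Y,X)\,C^{(n,\lambda)}_Y$ for $a\in A_n$. **Hereditary cellular category.** A cellular category $\mathcal{A}$ such that (1) its object set is $\mathbb{N}$; (2) for all $m\le n$ in $\mathbb{N}$ with $\mathrm{Hom}_{\mathcal{A}}(m,n)\neq0$, $\Lambda_m$ is a saturated ordered subset of $\Lambda_n$,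 i.e. $\Lambda_m\subset\Lambda_n$ (preserving order), and if $\lambda<\mu$ with $\mu\in\Lambda_m$, $\lambda\in\Lambda_n$, then $\lambda\in\Lambda_m$; (3) each $A_n$ is quasi-hereditary (for a cellular algebra this is equivalent, by a known theorem of König and Xi, to the canonical bilinear form on every cell module being nonzero). **Cellular tower category.** A hereditary cellular category satisfying (A1)–(A4): (A1) For each $n\ge0$ the algebra $A_n$ is identified with a subalgebra of $A_{n+1}$, with the same identity. One then has the restriction functor $\mathrm{Res}_{n+1}:A_{n+1}\text{-mod}\to A_n\text{-mod}$ and the induction functor $\mathrm{Ind}_n=A_{n+1}\otimes_{A_n}-:A_n\text{-mod}\to A_{n+1}\text{-mod}$. (A2) For all $n\ge2$ there is an isomorphism of $A_{n-1}$-$A_{n-2}$-bimodules $\mathrm{Hom}_{\mathcal{A}}(n,n-2)\simeq A_{n-1}$. If an $A_n$-module $M$ has a $\Delta_n$-filtration, i.e. a filtration with successive quotients isomorphic to cell modules $\Delta_n(\lambda)$, then $\mathrm{supp}_n(M)$ denotes the set of labels $\lambda$ for which $\Delta_n(\lambda)$ occurs in this filtration. (A3) For all $m\le n$ in $\mathbb{N}$ with $n\geq 1$ and $n-m$ even, and all $\lambda\in\Lambda_m\setminus\Lambda_{m-2}$, the module $\mathrm{Res}_n(\Delta_n(\lambda))$ has a $\Delta_{n-1}$-filtration and $$\mathrm{supp}_{n-1}(\mathrm{Res}_n(\Delta_n(\lambda)))\subseteq\big((\Lambda_{m-1}\setminus\Lambda_{m-3})\cup(\Lambda_{m+1}\setminus\Lambda_{m-1})\big)\cap\Lambda_{n-1}.$$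 (It follows from (A1)–(A3) that $\mathrm{Ind}_n(\Delta_n(\lambda))$ has a $\Delta_{n+1}$-filtration.) (A4) For each $n\ge1$ and each $\lambda\in\Lambda_n\setminus\Lambda_{n-2}$ there exists $\mu\in\Lambda_{n-1}\setminus\Lambda_{n-3}$ such that $\lambda\in\mathrm{supp}_n(\mathrm{Ind}_{n-1}(\Delta_{n-1}(\mu)))$. *)

(* Defs.v *)
From HB Require Import structures.
From mathcomp Require Import all_boot all_order all_algebra.

Set Implicit Arguments.
Unset Strict Implicit.
Unset Printing Implicit Defensive.

Import Order.TTheory GRing.Theory.
Local Open Scope ring_scope.

(** * Finite-dimensional algebras and their modules *)

Section Algebras.
Variable K : fieldType.

Definition bilinear_map (U V W : vectType K) (u : U -> V -> W) : Prop :=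
  (forall x, linear (u x)) /\ (forall y, linear (u^~ y)).

(* [falgType] is not used because it excludes the zero algebra, which is a
   legitimate endomorphism algebra. *)
Record finalg := FinAlg {
  alg_space :> vectType K;
  amul : alg_space -> alg_space -> alg_space;
  aone : alg_space;
  amul_bilin : bilinear_map amul;
  amulA : associative amul;
  amul1l : left_id aone amul;
  amul1r : right_id aone amul }.

Record alghom (A B : finalg) := AlgHom {
  alghom_fun :> 'Hom(A, B);
  alghomM : forall x y, alghom_fun (amul x y) = amul (alghom_fun x) (alghom_fun y);
  alghom1 : alghom_fun (aone A) = aone B }.

(* Over a finite-dimensional algebra, finitely generated modules are the
   unitary modules whose underlying K-space is finite-dimensional. *)
Record amod (A : finalg) := AMod {
  mod_space :> vectType K;
  mact : A -> mod_space -> mod_space;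
  mact_bilin : bilinear_map mact;
  mactM : forall a b x, mact (amul a b) x = mact a (mact b x);
  mact1 : forall x, mact (aone A) x = x }.

Definition modhom (A : finalg) (M N : amod A) (f : 'Hom(M, N)) : Prop :=
  forall a x, f (mact a x) = mact a (f x).

Definition submodule (A : finalg) (M : amod A) (U : {vspace M}) : Prop :=
  forall a x, x \in U -> mact a x \in U.

Definition regular (A : finalg) : amod A :=
  @AMod A A (@amul A) (amul_bilin A) (fun a b x => esym (amulA a b x))
    (@amul1l A).

Section Submod.
Variables (A : finalg) (M : amod A) (U : {vspace M}) (hU : submodule U).

Definition sub_act (a : A) (x : subvs_of U) : subvs_of U :=
  vsproj U (mact a (vsval x)).

Lemma vsval_sub_act a x : vsval (sub_act a x) = mact a (vsval x).
Proof. by rewrite vsprojK // hU ?subvsP. Qed.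

Lemma sub_act_bilin : bilinear_map sub_act.
Proof.
have [l r] := mact_bilin M.
have vP k (x y : subvs_of U) : vsval (k *: x + y) = k *: vsval x + vsval y.
  by [].
by split=> [a k x y | x k a b]; apply: val_inj;
  rewrite /= !vsval_sub_act ?vP ?l ?r.
Qed.

Lemma sub_actM a b x : sub_act (amul a b) x = sub_act a (sub_act b x).
Proof. by apply: val_inj; rewrite /= !vsval_sub_act mactM. Qed.

Lemma sub_act1 x : sub_act (aone A) x = x.
Proof. by apply: val_inj; rewrite /= !vsval_sub_act mact1. Qed.

Definition submod : amod A :=
  @AMod A (subvs_of U) sub_act sub_act_bilin sub_actM sub_act1.

End Submod.

(** ** Semisimplicity *)

Definition simple_submodule (A : finalg) (M : amod A) (S : {vspace M}) : Prop :=
  [/\ submodule S, S != 0%VS &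
      forall T : {vspace M}, submodule T -> (T <= S)%VS ->
        T = 0%VS \/ T = S].

Definition semisimple_module (A : finalg) (M : amod A) : Prop :=
  exists (k : nat) (S : 'I_k -> {vspace M}),
    [/\ forall i, simple_submodule (S i), directv (\sum_i S i)
      & (\sum_i S i)%VS = fullv].

Definition semisimple_algebra (A : finalg) : Prop :=
  semisimple_module (regular A).

(** ** Quasi-hereditary algebras *)

Definition projective (A : finalg) (P : amod A) : Prop :=
  forall (M N : amod A) (g : 'Hom(M, N)) (f : 'Hom(P, N)),
    modhom g -> limg g = fullv -> modhom f ->
    exists h : 'Hom(P, M), modhom h /\ forall x, g (h x) = f x.

Definition two_sided_ideal (A : finalg) (J : {vspace A}) : Prop :=
  forall a x, x \in J -> amul a x \in J /\ amul x a \in J.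

Definition ideal_prod (A : finalg) (I J : {vspace A}) : {vspace A} :=
  <<[seq amul x y | x <- vbasis I, y <- vbasis J]>>%VS.

Definition maximal_left_ideal (A : finalg) (L : {vspace A}) : Prop :=
  [/\ submodule (L : {vspace regular A}), L != fullv &
      forall L' : {vspace A}, submodule (L' : {vspace regular A}) ->
        (L <= L')%VS -> L' = L \/ L' = fullv].

Definition in_radical (A : finalg) (x : A) : Prop :=
  forall L : {vspace A}, maximal_left_ideal L -> x \in L.

Definition heredity_ideal (A : finalg) (J : {vspace A}) : Prop :=
  [/\ two_sided_ideal J,
      ideal_prod J J = J,
      forall x y z, x \in J -> in_radical y -> z \in J ->
        amul (amul x y) z = 0
    & exists hJ : submodule (J : {vspace regular A}), projective (submod hJ)].

(* A/I is presented as any algebra B with a surjective pi : A -> B of kernel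
   I; then J/I is the image of J under pi. *)
Definition heredity_quotient (A : finalg) (I J : {vspace A}) : Prop :=
  exists (B : finalg) (pi : alghom A B),
    [/\ limg pi = fullv, lker pi = I & heredity_ideal (pi @: J)%VS].

Definition quasi_hereditary (A : finalg) : Prop :=
  exists (t : nat) (J : nat -> {vspace A}),
    [/\ J 0%N = 0%VS, J t = fullv,
        forall i, (i <= t)%N -> two_sided_ideal (J i)
      & forall i, (i < t)%N ->
          (J i <= J i.+1)%VS /\ heredity_quotient (J i) (J i.+1)].

(** ** Restriction and induction along an algebra homomorphism *)

Section Change.
Variables (A B : finalg) (f : alghom A B).

Section Res.
Variable M : amod B.

Definition res_act (a : A) (x : M) : M := mact (f a) x.

Lemma res_act_bilin : bilinear_map res_act.
Proof.
have [l r] := mact_bilin M.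
split=> [a k x y | x k a b]; rewrite /res_act ?l //.
by rewrite linearP r.
Qed.

Lemma res_actM a b x : res_act (amul a b) x = res_act a (res_act b x).
Proof. by rewrite /res_act alghomM mactM. Qed.

Lemma res_act1 x : res_act (aone A) x = x.
Proof. by rewrite /res_act alghom1 mact1. Qed.

Definition Res : amod A := @AMod A M res_act res_act_bilin res_actM res_act1.

End Res.

Definition balanced (M : amod A) (W : vectType K) (u : B -> M -> W) : Prop :=
  bilinear_map u /\ forall b a x, u (amul b (f a)) x = u b (mact a x).

(* T is the B-module B (x)_A M, where t b x stands for b (x) x. *)
Definition is_tensor (M : amod A) (T : amod B) (t : B -> M -> T) : Prop :=
  [/\ balanced t,
      forall b' b x, mact b' (t b x) = t (amul b' b) x
    & forall (W : vectType K) (u : B -> M -> W), balanced u ->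
        exists! g : 'Hom(T, W), forall b x, g (t b x) = u b x].

Definition is_Ind (M : amod A) (T : amod B) : Prop :=
  exists t : B -> M -> T, is_tensor t.

End Change.

(** ** The first extension group, as classes of Yoneda extensions *)

Section Ext.
Variable A : finalg.

Record extension (M N : amod A) := Extension {
  ext_mid : amod A;
  ext_inj : 'Hom(N, ext_mid);
  ext_proj : 'Hom(ext_mid, M);
  ext_inj_hom : modhom ext_inj;
  ext_proj_hom : modhom ext_proj;
  ext_injective : lker ext_inj = 0%VS;
  ext_exact : limg ext_inj = lker ext_proj;
  ext_surjective : limg ext_proj = fullv }.

Definition ext_equiv (M N : amod A) (E E' : extension M N) : Prop :=
  exists g : 'Hom(ext_mid E, ext_mid E'),
    [/\ modhom g,
        forall x, g (ext_inj E x) = ext_inj E' x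
      & forall y, ext_proj E' (g y) = ext_proj E y].

Section Split.
Variables M N : amod A.

Definition dsum_act (a : A) (x : N * M) : (N * M)%type :=
  (mact a x.1, mact a x.2).

Lemma dsum_act_bilin : bilinear_map dsum_act.
Proof.
have [lN rN] := mact_bilin N; have [lM rM] := mact_bilin M.
split=> [a k x y | x k a b]; rewrite /dsum_act /=.
  by rewrite lN lM.
by rewrite (rN x.1 k a b) (rM x.2 k a b).
Qed.

Lemma dsum_actM a b x : dsum_act (amul a b) x = dsum_act a (dsum_act b x).
Proof. by rewrite /dsum_act !mactM. Qed.

Lemma dsum_act1 x : dsum_act (aone A) x = x.
Proof. by case: x => x y; rewrite /dsum_act !mact1. Qed.

Definition dsum : amod A :=
  @AMod A (N * M)%type dsum_act dsum_act_bilin dsum_actM dsum_act1.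

Definition dsum_in (x : N) : (N * M)%type := (x, 0).
Definition dsum_out (x : N * M) : M := x.2.

Lemma dsum_in_linear : linear dsum_in.
Proof. by move=> k x y; congr pair; rewrite /= scaler0 addr0. Qed.

Lemma dsum_out_linear : linear dsum_out.
Proof. by []. Qed.

HB.instance Definition _ :=
  GRing.isLinear.Build K N (N * M)%type _ dsum_in dsum_in_linear.
HB.instance Definition _ :=
  GRing.isLinear.Build K (N * M)%type M _ dsum_out dsum_out_linear.

Definition dsum_inj : 'Hom(N, dsum) := linfun dsum_in.
Definition dsum_proj : 'Hom(dsum, M) := linfun dsum_out.

Lemma dsum_inj_hom : modhom dsum_inj.
Proof.
move=> a x; rewrite !lfunE /= /dsum_act /dsum_in /=.
have [l _] := mact_bilin M.
have := l a (-1) 0 0; rewrite scaler0 addr0 scaleN1r addNr => ->.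
by [].
Qed.

Lemma dsum_proj_hom : modhom dsum_proj.
Proof. by move=> a x; rewrite !lfunE. Qed.

Lemma dsum_injective : lker dsum_inj = 0%VS.
Proof.
apply/eqP; rewrite -subv0; apply/subvP=> x.
by rewrite memv_ker lfunE memv0 /= => /eqP[->].
Qed.

Lemma dsum_exact : limg dsum_inj = lker dsum_proj.
Proof.
apply/vspaceP=> -[x y]; rewrite memv_ker lfunE /= /dsum_out /=.
apply/memv_imgP/eqP=> [[z _] | ->]; first by rewrite lfunE /= => -[].
by exists x; rewrite ?memvf // lfunE.
Qed.

Lemma dsum_surjective : limg dsum_proj = fullv.
Proof.
apply/vspaceP=> y; rewrite memvf; apply/memv_imgP.
by exists (0, y); rewrite ?memvf // lfunE.
Qed.

Definition split_extension : extension M N :=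
  Extension dsum_inj_hom dsum_proj_hom dsum_injective dsum_exact
    dsum_surjective.

End Split.

(* Ext^1_A(M, N) = 0: every class equals that of the split extension, which is
   the zero of the Baer sum. *)
Definition Ext1_eq0 (M N : amod A) : Prop :=
  forall E : extension M N, ext_equiv E (split_extension M N).

End Ext.

End Algebras.

(** * Linear and cellular categories *)

(* Composition is written from left to right. *)
Record lincat (K : fieldType) (Ob : Type) := LinCat {
  hom : Ob -> Ob -> vectType K;
  comp : forall p m n, hom p m -> hom m n -> hom p n;
  idm : forall n, hom n n;
  comp_bilin : forall p m n, bilinear_map (@comp p m n);
  compA : forall p q m n (a : hom p q) (b : hom q m) (c : hom m n),
    comp a (comp b c) = comp (comp a b) c;
  comp1m : forall m n (a : hom m n), comp (idm m) a = a;
  compm1 : forall m n (a : hom m n), comp a (idm n) = a }.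

Arguments comp {K Ob l p m n}.
Arguments idm {K Ob l}.

Definition endalg (K : fieldType) (Ob : Type) (C : lincat K Ob) (n : Ob) :
    finalg K :=
  FinAlg (comp_bilin C n n n) (@compA _ _ C n n n n)
    (@comp1m _ _ C n n) (@compm1 _ _ C n n).

Definition in_span (K : fieldType) (V : vectType K) (P : V -> Prop) (v : V) :
    Prop :=
  exists s : seq V, (forall x, x \in s -> P x) /\ v \in <<s>>%VS.

(* [cell_r a S' S] is the coefficient r_a(S', S); it is determined by the
   other data because M(n, lambda) is inhabited (by S) when n := m. *)
Record cellular (K : fieldType) (Ob : Type) (C : lincat K Ob) := Cellular {
  star : forall m n, hom C m n -> hom C n m;
  star_linear : forall m n, linear (@star m n);
  star_comp : forall p m n (a : hom C p m) (b : hom C m n),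
    star (comp a b) = comp (star b) (star a);
  star_id : forall n, star (idm n) = idm n;
  starK : forall m n (a : hom C m n), star (star a) = a;
  cell_disp : Order.disp_t;
  Lam : porderType cell_disp;
  cell_M : Ob -> Lam -> finType;
  cell_C : forall m n (l : Lam), cell_M m l -> cell_M n l -> hom C m n;
  cell_r : forall p m (l : Lam), hom C p m -> cell_M p l -> cell_M m l -> K;
  cell_basis : forall m n,
    let c (i : {l : Lam & (cell_M m l * cell_M n l)%type}) :=
      cell_C (tagged i).1 (tagged i).2 in
    injective c /\
    exists B : seq (hom C m n),
      basis_of fullv B /\ forall v, v \in B <-> exists i, c i = v;
  cell_star : forall m n l (S : cell_M m l) (T : cell_M n l),
    star (cell_C S T) = cell_C T S;
  cell_mul : forall p m n l (a : hom C p m) (S : cell_M m l) (T : cell_M n l),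
    in_span
      (fun x => exists (l' : Lam) (S' : cell_M p l') (T' : cell_M n l'),
         (l' < l)%O /\ x = cell_C S' T')
      (comp a (cell_C S T) - \sum_S' cell_r a S' S *: cell_C S' T) }.

Arguments cell_C {K Ob C} c {m n l}.
Arguments cell_r {K Ob C} c {p m l}.

Section CellModules.
Variables (K : fieldType) (Ob : Type) (C : lincat K Ob) (c : cellular C).

Definition below (l : Lam c) (p n : Ob) (x : hom C p n) : Prop :=
  exists (l' : Lam c) (S : cell_M p l') (T : cell_M n l'),
    (l' < l)%O /\ x = cell_C c S T.

Definition cell_ix (m n : Ob) (i : {l : Lam c & (cell_M m l * cell_M n l)%type}) :=
  cell_C c (tagged i).1 (tagged i).2.

Lemma in_span_gen (V : vectType K) (P : V -> Prop) x : P x -> in_span P x.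
Proof.
by move=> Px; exists [:: x]; split=> [y|];
  rewrite ?mem_seq1 ?span_seq1 ?memv_line // => /eqP->.
Qed.

Lemma in_span0 (V : vectType K) (P : V -> Prop) : in_span P 0.
Proof. by exists [::]; split=> //; rewrite mem0v. Qed.

Lemma in_spanD (V : vectType K) (P : V -> Prop) x y :
  in_span P x -> in_span P y -> in_span P (x + y).
Proof.
move=> [s [Ps xs]] [t [Pt yt]]; exists (s ++ t); split.
  by move=> z; rewrite mem_cat => /orP[/Ps|/Pt].
by rewrite span_cat memv_add.
Qed.

Lemma in_spanZ (V : vectType K) (P : V -> Prop) k x :
  in_span P x -> in_span P (k *: x).
Proof. by move=> [s [Ps xs]]; exists s; rewrite memvZ. Qed.

Lemma in_span_sum (V : vectType K) (P : V -> Prop) (I : Type) (s : seq I)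
    (F : I -> V) :
  (forall i, in_span P (F i)) -> in_span P (\sum_(i <- s) F i).
Proof.
by move=> PF; elim/big_rec: _ => [|i x _ Px];
  [apply: in_span0 | apply: in_spanD].
Qed.

Lemma in_span_map (V W : vectType K) (P : V -> Prop) (Q : W -> Prop)
    (f : V -> W) :
  linear f -> (forall x, P x -> in_span Q (f x)) ->
  forall x, in_span P x -> in_span Q (f x).
Proof.
move=> linf PQ x [s [Ps xs]].
pose g : {linear V -> W} := HB.pack f (GRing.isLinear.Build _ _ _ _ f linf).
rewrite (coord_span (X := in_tuple s) xs) -[f _]/(g _) linear_sum.
apply: in_span_sum => i; rewrite linearZ; apply: in_spanZ; apply: PQ.
by apply: Ps; rewrite mem_nth.
Qed.

Lemma cell_coord m n (i : {l : Lam c & (cell_M m l * cell_M n l)%type}) :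
  exists phi : {linear hom C m n -> K^o},
    forall j, phi (cell_ix j) = (j == i)%:R.
Proof.
have [inj [B [basB memB]]] := cell_basis c m n.
have Bix j : cell_ix j \in B by apply/memB; exists j.
have lt_i : (index (cell_ix i) B < size B)%N by rewrite index_mem.
exists (coord (in_tuple B) (Ordinal lt_i)) => j.
have lt_j : (index (cell_ix j) B < size B)%N by rewrite index_mem.
have -> : cell_ix j = (in_tuple B)`_(Ordinal lt_j) by rewrite nth_index.
have freeB : free (in_tuple B) := basis_free basB.
rewrite [LHS](coord_free (Ordinal lt_j) (Ordinal lt_i) freeB) -val_eqE /=.
congr (_%:R : K); congr nat_of_bool.
apply/eqP/eqP=> [e|-> //]; apply: inj; rewrite -!/(cell_ix _).
by rewrite -[RHS](nth_index 0 (Bix i)) -e nth_index.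
Qed.

Lemma below_indep l m n (T : cell_M n l) (k : cell_M m l -> K) :
  in_span (@below l m n) (\sum_S k S *: cell_C c S T) -> forall S, k S = 0.
Proof.
move=> bel S; have [phi phiE] := cell_coord (Tagged _ (S, T)).
have phi0 x : in_span (@below l m n) x -> phi x = 0.
  move=> [s [Ps xs]]; rewrite (coord_span (X := in_tuple s) xs) linear_sum big1 // => i _.
  have [l' [S' [T' [lt_l ->]]]] := Ps _ (mem_nth 0 (ltn_ord i)).
  rewrite linearZ -[cell_C c _ _]/(cell_ix (Tagged _ (S', T'))) phiE.
  case: eqP => [e|_]; last by rewrite /= mulr0n scaler0.
  by have := congr1 tag e; rewrite /= => e'; rewrite e' ltxx in lt_l.
have := phi0 _ bel; rewrite linear_sum (bigD1 S) //= big1 => [|S' neS].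
  rewrite linearZ -[cell_C c _ _]/(cell_ix (Tagged _ (S, T))) phiE eqxx addr0.
  by move/eqP; rewrite scaler_eq0 /= mulr1n oner_eq0 orbF => /eqP.
rewrite linearZ -[cell_C c _ _]/(cell_ix (Tagged _ (S', T))) phiE.
case: eqP => [e|_]; last by rewrite /= mulr0n scaler0.
case/negP: neS; move/eqP: e; rewrite -tag_eqE /tag_eq eqxx tagged_asE.
by case/andP=> _; case/andP.
Qed.

Lemma cell_r_uniq l p m (a : hom C p m) (S : cell_M m l) (k : cell_M p l -> K) :
  in_span (@below l p m)
    (comp a (cell_C c S S) - \sum_S' k S' *: cell_C c S' S) ->
  forall S', cell_r c a S' S = k S'.
Proof.
move=> bel S'; apply/eqP; rewrite -subr_eq0; apply/eqP.
apply: (below_indep (T := S) (k := fun S' => cell_r c a S' S - k S')).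
under eq_bigr do rewrite scalerBl.
rewrite sumrB; have := in_spanD bel (in_spanZ (-1) (cell_mul a S S)).
rewrite scaleN1r opprB addrC addrA; congr in_span.
by rewrite subrK.
Qed.

Lemma below_comp l p m n (a : hom C p m) (x : hom C m n) :
  in_span (@below l m n) x -> in_span (@below l p n) (comp a x).
Proof.
apply: in_span_map; first exact: (comp_bilin C p m n).1.
move=> y [l' [S [T [lt_l ->]]]].
rewrite -[comp a _](subrK (\sum_S' cell_r c a S' S *: cell_C c S' T)).
apply: in_spanD.
  have [s [Ps xs]] := cell_mul a S T; exists s; split=> // z /Ps.
  by case=> l2 [S2 [T2 [lt2 ->]]]; exists l2, S2, T2; rewrite (lt_trans lt2).
apply: in_span_sum => S'; apply/in_spanZ/in_span_gen.
by exists l', S', T.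
Qed.

Lemma cell_rP l p m k (a b : hom C p m) (S' : cell_M p l) (S : cell_M m l) :
  cell_r c (k *: a + b) S' S = k * cell_r c a S' S + cell_r c b S' S.
Proof.
apply: (cell_r_uniq (k := fun S' => k * cell_r c a S' S + cell_r c b S' S)).
have [_ r] := comp_bilin C p m m; rewrite (r (cell_C c S S) k a b).
have := in_spanD (in_spanZ k (cell_mul a S S)) (cell_mul b S S).
congr in_span; under [in RHS]eq_bigr do rewrite scalerDl -scalerA.
by rewrite big_split /= -scaler_sumr scalerBr opprD addrACA.
Qed.

Lemma cell_r1 l n (S' S : cell_M n l) :
  cell_r c (idm n) S' S = (S' == S)%:R.
Proof.
apply: (cell_r_uniq (k := fun S' => (S' == S)%:R)).
rewrite comp1m (bigD1 S) //= eqxx scale1r big1 ?addr0 ?subrr.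
  exact: in_span0.
by move=> T /negPf->; rewrite scale0r.
Qed.

Lemma cell_rM l p q m (a : hom C p q) (b : hom C q m)
    (S' : cell_M p l) (S : cell_M m l) :
  cell_r c (comp a b) S' S =
  \sum_(X : cell_M q l) cell_r c a S' X * cell_r c b X S.
Proof.
apply: (cell_r_uniq
  (k := fun S' => \sum_(X : cell_M q l) cell_r c a S' X * cell_r c b X S)).
have [lin _] := comp_bilin C p q m.
pose f : {linear hom C q m -> hom C p m} :=
  HB.pack (comp a) (GRing.isLinear.Build _ _ _ _ _ (lin a)).
have fZ k x : comp a (k *: x) = k *: comp a x := linearZ_LR f k x.
have h1 := below_comp a (cell_mul b S S).
have h2 : in_span (@below l p m)
  (\sum_X cell_r c b X S *:
     (comp a (cell_C c X S) - \sum_S' cell_r c a S' X *: cell_C c S' S)).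
  by apply: in_span_sum => X; apply: in_spanZ; apply: cell_mul.
have := in_spanD h1 h2; congr in_span.
rewrite -compA -![comp a _]/(f _) linearB linear_sum /=.
under [X in _ + X]eq_bigr do rewrite scalerBr.
rewrite sumrB addrA; congr (_ - _).
  by under eq_bigr do rewrite fZ; rewrite subrK.
transitivity (\sum_X \sum_Y
    (cell_r c b X S * cell_r c a Y X) *: cell_C c Y S).
  apply: eq_bigr => X _; rewrite scaler_sumr; apply: eq_bigr => Y _.
  by rewrite scalerA.
rewrite exchange_big /=; apply: eq_bigr => Y _; rewrite scaler_suml.
by apply: eq_bigr => X _; rewrite mulrC.
Qed.

Variables (n : Ob) (l : Lam c).

Definition cell_space : vectType K := {ffun cell_M n l -> K^o}.

(* f stands for \sum_X f X C_X. *)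
Definition cell_act (a : endalg C n) (f : cell_space) : cell_space :=
  [ffun Y => \sum_X cell_r c a Y X * f X].

Lemma cell_act_bilin : bilinear_map cell_act.
Proof.
have scE (k : K) (x : K^o) : k *: x = k * x by [].
split=> [a k f g | f k a b]; apply/ffunP=> Y; rewrite !ffunE scE mulr_sumr
  -big_split; apply: eq_bigr => X _ /=.
  by rewrite !ffunE scE mulrDr mulrCA.
by rewrite cell_rP mulrDl mulrA.
Qed.

Lemma cell_actM (a b : endalg C n) f :
  cell_act (amul a b) f = cell_act a (cell_act b f).
Proof.
apply/ffunP=> Y; rewrite !ffunE.
under eq_bigr do rewrite cell_rM mulr_suml.
rewrite exchange_big /=; apply: eq_bigr => X _; rewrite ffunE mulr_sumr.
by apply: eq_bigr => Z _; rewrite mulrA.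
Qed.

Lemma cell_act1 f : cell_act (aone (endalg C n)) f = f.
Proof.
apply/ffunP=> Y; rewrite ffunE (bigD1 Y) //= cell_r1 eqxx mul1r big1 ?addr0 //.
by move=> X neX; rewrite cell_r1 eq_sym (negPf neX) mul0r.
Qed.

(* The cell module Delta_n(l); it is 0 when l is not in Lambda_n. *)
Definition Delta : amod (endalg C n) :=
  @AMod K (endalg C n) cell_space cell_act cell_act_bilin cell_actM cell_act1.

End CellModules.

(** * Hereditary cellular categories and cellular tower categories *)

Section Tower.
Variables (K : fieldType) (C : lincat K nat) (c : cellular C).

(* Lambda_k for k : int, empty for k < 0. *)
Definition LamZ (k : int) : {pred Lam c} :=
  fun l => if k is Posz n then (0 < #|cell_M n l|)%N else false.

Definition saturated (P Q : {pred Lam c}) : Prop :=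
  {subset P <= Q} /\
  forall l m : Lam c, (l < m)%O -> m \in P -> l \in Q -> l \in P.

Record hereditary : Prop := Hereditary {
  her_saturated : forall m n : nat, (m <= n)%N ->
    (exists f : hom C m n, f != 0) -> saturated (LamZ m) (LamZ n);
  her_qh : forall n, quasi_hereditary (endalg C n) }.

(* U / W is isomorphic to N: f restricts to a surjective module homomorphism
   U -> N with kernel W.  Every linear map on U extends to M. *)
Definition subquotient_iso (A : finalg K) (M : amod A) (U W : {vspace M})
    (N : amod A) : Prop :=
  exists f : 'Hom(M, N),
    [/\ forall a x, x \in U -> f (mact a x) = mact a (f x),
        (f @: U)%VS = fullv & (U :&: lker f)%VS = W].

(* M has a filtration 0 = F 0 <= F 1 <= ... <= F (size s) = M whose successive
   quotients are the cell modules labelled by s; the support of M computed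
   from this filtration is the set of members of s. *)
Definition Delta_filtration (n : nat) (M : amod (endalg C n))
    (s : seq (Lam c)) : Prop :=
  exists F : nat -> {vspace M},
    [/\ F 0%N = 0%VS, F (size s) = fullv,
        forall i, (i <= size s)%N -> submodule (F i),
        {subset s <= LamZ n}
      & forall l0 i, (i < size s)%N -> (F i <= F i.+1)%VS /\
          subquotient_iso (F i.+1) (F i) (Delta n (nth l0 s i))].

Variable incl : forall n, alghom (endalg C n) (endalg C n.+1).

Definition axiom_A1 : Prop := forall n, injective (incl n).

(* Hom(n+2, n) and A_(n+1) are isomorphic A_(n+1)-A_n-bimodules, the missing
   actions being restricted along A_(n+1) -> A_(n+2) and A_n -> A_(n+1). *)
Definition axiom_A2 : Prop := forall n : nat,
  exists phi : 'Hom(hom C n.+2 n, endalg C n.+1),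
    bijective phi /\
    forall (a : endalg C n.+1) (x : hom C n.+2 n) (b : endalg C n),
      phi (comp (comp (incl n.+1 a) x) b) =
      amul (amul a (phi x)) (incl n b).

Definition axiom_A3 : Prop := forall (m n : nat) (l : Lam c),
  (m <= n.+1)%N -> ~~ odd (n.+1 - m) ->
  l \in LamZ m%:Z -> l \notin LamZ (m%:Z - 2) ->
  exists s : seq (Lam c),
    Delta_filtration (Res (incl n) (Delta n.+1 l)) s /\
    forall l', l' \in s ->
      ((l' \in LamZ (m%:Z - 1)) && (l' \notin LamZ (m%:Z - 3))
       || (l' \in LamZ (m%:Z + 1)) && (l' \notin LamZ (m%:Z - 1)))
      && (l' \in LamZ n%:Z).

Definition axiom_A4 : Prop := forall (n : nat) (l : Lam c),
  l \in LamZ n.+1%:Z -> l \notin LamZ (n.+1%:Z - 2) ->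
  exists mu : Lam c,
    [/\ mu \in LamZ n%:Z, mu \notin LamZ (n%:Z - 2)
      & exists (T : amod (endalg C n.+1)) (s : seq (Lam c)),
          [/\ is_Ind (incl n) (Delta n mu) T, Delta_filtration T s & l \in s]].

End Tower.

Record cellular_tower (K : fieldType) := CellularTower {
  tower_cat : lincat K nat;
  tower_cell : cellular tower_cat;
  tower_her : hereditary tower_cell;
  tower_incl : forall n, alghom (endalg tower_cat n) (endalg tower_cat n.+1);
  tower_A1 : axiom_A1 tower_incl;
  tower_A2 : axiom_A2 tower_incl;
  tower_A3 : axiom_A3 tower_cell tower_incl;
  tower_A4 : axiom_A4 tower_cell tower_incl }.

(* Main.v *)
(* For D a lower set of labels, let A_D be the span of the cellular basis
   elements of A_n with label in D, and let I and I' be the ideals A_D for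
   D = Lambda_(n-2) and D = Lambda_(n-4).  The algebra A_n is semisimple as soon
   as every A_D has a two-sided identity e_D, because then each left ideal
   spanned by the C_(S,T) (1 - e_D), for a fixed T and a label minimal outside
   D, is simple or zero.

   Identity of I, by induction on n: the hypothesis on Ext^1 splits A_n / I' as
   I / I' + A_n / I, whence an element of I acting as 1 on the cell modules
   labelled by Lambda_(n-2) \ Lambda_(n-4).  Let eps be the identity of the
   analogous ideal of A_(n-1).  By (A2) the left module A_n is the restriction
   of Hom(n+1, n-1); by (A3) its quotient by A_n eps is filtered by cell modules
   with labels outside Lambda_(n-4), on which Ext^1 vanishes, and eps lies in I.
   Splitting the sections labelled outside Lambda_(n-2) gives an h congruent to
   1 modulo I with I h = 0, and 1 - h is a right identity of I; the involution
   makes it two-sided.  The same splitting gives e_D for D containing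
   Lambda_(n-2).

   For D inside Lambda_(n-2), the ideal I equals Hom(n, n-2) Hom(n-2, n), so the
   identity of I is a sum of x_i y_i, and e_D is the sum of x_i f y_i, where f
   is the element e_D of A_(n-2). *)
From HB Require Import structures.
From mathcomp Require Import all_boot all_order all_algebra boolp.
Require Import Defs.

Set Implicit Arguments.
Unset Strict Implicit.
Unset Printing Implicit Defensive.

Import Order.TTheory GRing.Theory.
Local Open Scope ring_scope.

(** * Modules over finite-dimensional algebras *)

Section Bilinear.
Variables (K : fieldType) (U V W : vectType K) (u : U -> V -> W).
Hypothesis hu : bilinear_map u.

Lemma bilin_homr x : exists f : 'Hom(V, W), forall y, f y = u x y.
Proof.
pose g : {linear V -> W} := HB.pack (u x) (GRing.isLinear.Build _ _ _ _ _ (hu.1 x)).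
by exists (linfun g) => y; rewrite lfunE.
Qed.

Lemma bilin_homl y : exists f : 'Hom(U, W), forall x, f x = u x y.
Proof.
pose g : {linear U -> W} := HB.pack (u^~ y) (GRing.isLinear.Build _ _ _ _ _ (hu.2 y)).
by exists (linfun g) => x; rewrite lfunE.
Qed.

Lemma bilinr0 x : u x 0 = 0.
Proof. by have [f <-] := bilin_homr x; rewrite linear0. Qed.

Lemma bilinl0 y : u 0 y = 0.
Proof. by have [f <-] := bilin_homl y; rewrite linear0. Qed.

Lemma bilinrD x y z : u x (y + z) = u x y + u x z.
Proof. by have [f fE] := bilin_homr x; rewrite -!fE linearD. Qed.

Lemma bilinlD x y z : u (x + y) z = u x z + u y z.
Proof. by have [f fE] := bilin_homl z; rewrite -!fE linearD. Qed.

Lemma bilinrB x y z : u x (y - z) = u x y - u x z.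
Proof. by have [f fE] := bilin_homr x; rewrite -!fE linearB. Qed.

Lemma bilinlB x y z : u (x - y) z = u x z - u y z.
Proof. by have [f fE] := bilin_homl z; rewrite -!fE linearB. Qed.

Lemma bilinrZ x k y : u x (k *: y) = k *: u x y.
Proof. by have [f fE] := bilin_homr x; rewrite -!fE linearZ. Qed.

Lemma bilinlZ k x y : u (k *: x) y = k *: u x y.
Proof. by have [f fE] := bilin_homl y; rewrite -!fE linearZ. Qed.

Lemma bilinr_sum x I (r : seq I) (F : I -> V) :
  u x (\sum_(i <- r) F i) = \sum_(i <- r) u x (F i).
Proof.
have [f fE] := bilin_homr x; rewrite -fE linear_sum.
by apply: eq_bigr => i _; rewrite /= fE.
Qed.

Lemma bilinl_sum I (r : seq I) (F : I -> U) y :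
  u (\sum_(i <- r) F i) y = \sum_(i <- r) u (F i) y.
Proof.
have [f fE] := bilin_homl y; rewrite -fE linear_sum.
by apply: eq_bigr => i _; rewrite /= fE.
Qed.

Lemma bilin_span (s : seq U) (t : seq V) (Z : {vspace W}) :
  (forall x y, x \in s -> y \in t -> u x y \in Z) ->
  forall x y, x \in <<s>>%VS -> y \in <<t>>%VS -> u x y \in Z.
Proof.
move=> st x y xs; have [f fE] := bilin_homr x; rewrite -fE memv_preim.
move: y; apply/subvP/span_subvP=> y yt; rewrite -memv_preim fE.
have [g gE] := bilin_homl y; rewrite -gE memv_preim.
by move: x xs {f fE}; apply/subvP/span_subvP=> x xs; rewrite -memv_preim gE st.
Qed.

End Bilinear.

Lemma span_rect (K : fieldType) (V : vectType K) (P : V -> Prop) (s : seq V) :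
  P 0 -> (forall k x y, P x -> P y -> P (k *: x + y)) ->
  (forall x, x \in s -> P x) -> forall x, x \in <<s>>%VS -> P x.
Proof.
move=> P0 Plin; elim: s => [_ x|v s IH Ps x].
  by rewrite span_nil memv0 => /eqP->.
rewrite span_cons => /memv_addP[_ /vlineP[k ->] [y ys ->]].
apply: Plin; first exact/Ps/mem_head.
by apply: IH ys => z zs; apply: Ps; rewrite inE zs orbT.
Qed.

Section RankOne.
Variables (K : fieldType) (V W : vectType K) (phi : 'Hom(V, K^o)) (w : W).

Let rank1_fun (x : V) : W := (phi x : K) *: w.

Let rank1_linear : linear rank1_fun.
Proof. by move=> k x y; rewrite /rank1_fun linearP scalerDl scalerA. Qed.

Definition rank1 : 'Hom(V, W) :=
  linfun (HB.pack rank1_fun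
    (GRing.isLinear.Build _ _ _ _ _ rank1_linear) : {linear V -> W}).

Lemma rank1E x : rank1 x = (phi x : K) *: w.
Proof. by rewrite lfunE. Qed.

End RankOne.

(** * Submodules and the splitting of extensions inside a module *)

Section Modules.
Variables (K : fieldType) (A : finalg K).

Section ModuleTheory.
Variable M : amod A.
Implicit Types (U V W : {vspace M}) (a b : A) (x y : M).

Lemma mactr0 a : mact a (0 : M) = 0.
Proof. exact: bilinr0 (mact_bilin M) a. Qed.

Lemma mactrD a x y : mact a (x + y) = mact a x + mact a y.
Proof. exact: bilinrD (mact_bilin M) a x y. Qed.

Lemma mactrB a x y : mact a (x - y) = mact a x - mact a y.
Proof. exact: bilinrB (mact_bilin M) a x y. Qed.

Lemma mactlB a b x : mact (a - b) x = mact a x - mact b x.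
Proof. exact: bilinlB (mact_bilin M) a b x. Qed.

Lemma submodule0 : submodule (0%VS : {vspace M}).
Proof. by move=> a x; rewrite !memv0 => /eqP->; rewrite mactr0. Qed.

Lemma submodule_full : submodule (fullv : {vspace M}).
Proof. by move=> a x _; rewrite memvf. Qed.

Lemma submoduleD U V : submodule U -> submodule V -> submodule (U + V)%VS.
Proof.
move=> hU hV a _ /memv_addP[x xU [y yV ->]]; rewrite mactrD.
by apply: memv_add; [apply: hU | apply: hV].
Qed.

Lemma submoduleI U V : submodule U -> submodule V -> submodule (U :&: V)%VS.
Proof.
by move=> hU hV a x; rewrite !memv_cap => /andP[xU xV]; rewrite hU ?hV.
Qed.

End ModuleTheory.

Lemma subquotient_isoP (M N : amod A) (U W : {vspace M}) (f : 'Hom(M, N)) :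
  (f @: U)%VS = fullv -> (U :&: lker f)%VS = W ->
  [/\ forall z, exists2 x, x \in U & f x = z,
      forall x, x \in U -> f x = 0 -> x \in W
    & forall x, x \in W -> x \in U /\ f x = 0].
Proof.
move=> fU fW; split=> [z | x xU fx0 | x].
- have := memvf z; rewrite -fU => /memv_imgP[x xU ->]; by exists x.
- by rewrite -fW memv_cap xU memv_ker fx0 /=.
- by rewrite -fW memv_cap memv_ker => /andP[-> /eqP].
Qed.

(* U' / U1 is realised on the space N1 * N2, with transported action: this is
   the Yoneda extension whose splitting provides the complement. *)
Section Splitting.
Variables (M N1 N2 : amod A) (U1 U U' : {vspace M}).
Hypotheses (hU : submodule U) (hU' : submodule U').
Hypotheses (UU' : (U <= U')%VS).
Variables (f1 : 'Hom(M, N1)) (f2 : 'Hom(M, N2)).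
Hypotheses (f1h : forall a x, x \in U -> f1 (mact a x) = mact a (f1 x)).
Hypotheses (f2h : forall a x, x \in U' -> f2 (mact a x) = mact a (f2 x)).
Hypotheses (f1U : (f1 @: U)%VS = fullv) (f1W : (U :&: lker f1)%VS = U1).
Hypotheses (f2U : (f2 @: U')%VS = fullv) (f2W : (U' :&: lker f2)%VS = U).

Let p (x : M) : (N1 * N2)%type := (f1 x, f2 x).

Let p_lin : linear p.
Proof. by move=> k x y; congr pair; rewrite /= linearP. Qed.

Let pl : {linear M -> (N1 * N2)%type} :=
  HB.pack p (GRing.isLinear.Build _ _ _ _ _ p_lin).

Let pU : 'Hom(subvs_of U', (N1 * N2)%type) := linfun (pl \o @vsval _ _ U').

Let pUE x : pU x = p (vsval x).
Proof. by rewrite lfunE. Qed.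

Let pU_surj : limg pU = fullv.
Proof.
have [f1s _ _] := subquotient_isoP f1U f1W.
have [f2s _ f2k] := subquotient_isoP f2U f2W.
apply/vspaceP=> -[z1 z2]; rewrite memvf.
have [x2 x2U f2x] := f2s z2; have [x1 x1U f1x] := f1s (z1 - f1 x2).
have [x1U' f2x1] := f2k _ x1U.
have xU' : x1 + x2 \in U' by rewrite memvD.
apply/memv_imgP; exists (Subvs xU'); rewrite ?memvf //.
by rewrite pUE /p /= !linearD /= f1x f2x f2x1 add0r subrK.
Qed.

Let sec (z : (N1 * N2)%type) : M := vsval ((pU^-1)%VF z).

Let sec_lin : linear sec.
Proof. by move=> k x y; rewrite /sec linearP. Qed.

Let secU z : sec z \in U'.
Proof. exact: subvsP. Qed.

Let secK z : p (sec z) = z.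
Proof. by rewrite -pUE limg_lfunVK // pU_surj memvf. Qed.

Let mid_act (a : A) (z : (N1 * N2)%type) : (N1 * N2)%type := p (mact a (sec z)).

(** The transported action does not depend on the representative: x and [sec (p x)] differ by an
    element killed by [f1] and [f2], which therefore lies in U, where both maps commute with the
    action. *)
Let pact a x : x \in U' -> p (mact a x) = mid_act a (p x).
Proof.
move=> xU'; have [_ f1k f1k'] := subquotient_isoP f1U f1W.
have [_ f2k f2k'] := subquotient_isoP f2U f2W.
pose d := x - sec (p x); have dU' : d \in U' by rewrite memvB.
have pd : p d = 0.
  by rewrite -[p _]/(pl _) linearB /= secK subrr.
have [d1 d2] : f1 d = 0 /\ f2 d = 0 by case: pd.
have dU : d \in U by exact: f2k.
have adU : mact a d \in U by exact: hU.
have pad : p (mact a d) = 0.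
  by rewrite /p f1h // f2h // d1 d2 !mactr0.
apply/eqP; rewrite -subr_eq0 /mid_act -![p _]/(pl _) -linearB -mactrB.
exact/eqP.
Qed.

Let mid_bilin : bilinear_map mid_act.
Proof.
have [l r] := mact_bilin M.
split=> [a k x y | x k a b]; rewrite /mid_act -![p _]/(pl _).
  by rewrite sec_lin l linearP.
by rewrite (r (sec x) k a b) linearP.
Qed.

Let mid_actM a b z : mid_act (amul a b) z = mid_act a (mid_act b z).
Proof. by rewrite {1}/mid_act mactM pact ?hU'. Qed.

Let mid_act1 z : mid_act (aone A) z = z.
Proof. by rewrite /mid_act mact1 secK. Qed.

Let mid : amod A := @AMod K A (N1 * N2)%type mid_act mid_bilin mid_actM mid_act1.

Let mid_inj : 'Hom(N1, mid) := dsum_inj N2 N1.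
Let mid_proj : 'Hom(mid, N2) := dsum_proj N2 N1.

Let mid_inj_hom : modhom mid_inj.
Proof.
move=> a z; rewrite /mid_inj !lfunE /= /dsum_in.
have [f1s _ _] := subquotient_isoP f1U f1W.
have [_ _ f2k] := subquotient_isoP f2U f2W.
have [x xU <-] := f1s z; have [xU' f2x] := f2k _ xU.
have -> : (f1 x, 0) = p x by rewrite /p f2x.
by rewrite -pact // /p f1h // f2h // f2x mactr0.
Qed.

Let mid_proj_hom : modhom mid_proj.
Proof.
by move=> a z; rewrite /mid_proj !lfunE /= /dsum_out f2h // -{2}[z]secK.
Qed.

Let mid_ext : extension N2 N1 :=
  Extension mid_inj_hom mid_proj_hom (dsum_injective N2 N1) (dsum_exact N2 N1)
    (dsum_surjective N2 N1).

(** The first component of a splitting of [mid_ext] yields a map R on U' that extends [f1] and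
    commutes with the action; V is its kernel in U'. *)
Lemma ext_split_aux : Ext1_eq0 N2 N1 ->
  exists V : {vspace M}, [/\ submodule V, (V <= U')%VS, (V :&: U)%VS = U1,
    (V + U)%VS = U' & subquotient_iso V U1 N2].
Proof.
have [f1s f1k f1k'] := subquotient_isoP f1U f1W.
have [f2s f2k f2k'] := subquotient_isoP f2U f2W.
case/(_ mid_ext)=> g [gh gi _].
pose r (x : M) : N1 := (g (p x : mid)).1.
have r_lin : linear r by move=> k x y; rewrite /r -![p _]/(pl _) linearP linearP.
pose rl : {linear M -> N1} := HB.pack r (GRing.isLinear.Build _ _ _ _ _ r_lin).
pose R : 'Hom(M, N1) := linfun rl.
have RE x : R x = r x by rewrite lfunE.
have Rh a x : x \in U' -> R (mact a x) = mact a (R x).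
  by move=> xU'; rewrite !RE /r pact //; have /= -> := gh a (p x).
have RU x : x \in U -> R x = f1 x.
  move=> xU; rewrite RE /r; have [_ f2x] := f2k' _ xU.
  have -> : p x = mid_inj (f1 x) by rewrite lfunE /= /p f2x.
  by have /= -> := gi (f1 x); rewrite lfunE.
pose V := (U' :&: lker R)%VS.
have VU' : (V <= U')%VS by rewrite capvSl.
have VcapU : (V :&: U)%VS = U1.
  apply/vspaceP=> x; rewrite !memv_cap memv_ker; apply/idP/idP.
    by case/andP=> /andP[xU' /eqP Rx] xU; apply: f1k; rewrite // -RU.
  by case/f1k' => xU f1x; rewrite xU RU // f1x eqxx (subvP UU').
have VU : (V + U)%VS = U'.
  apply/vspaceP=> x; apply/idP/idP => [|xU'].
    by apply/subvP; rewrite subv_add VU'.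
  have [u uU f1u] := f1s (R x).
  have uU' : u \in U' by apply: (subvP UU').
  rewrite -[x](subrK u); apply: memv_add => //.
  by rewrite memv_cap memvB //= memv_ker linearB /= [R u]RU // f1u subrr.
exists V; split=> //.
  move=> a x; rewrite !memv_cap !memv_ker => /andP[xU' /eqP Rx].
  by rewrite hU' // Rh // Rx mactr0 eqxx.
exists f2; split.
- by move=> a x /(subvP VU'); apply: f2h.
- apply/eqP; rewrite eqEsubv subvf -f2U -VU limgD subv_add subvv /=.
  apply/subvP=> _ /memv_imgP[x /f2k'[_ ->] ->]; exact: mem0v.
- by rewrite -VcapU -[in RHS]f2W capvA (capv_idPl VU').
Qed.

End Splitting.

Lemma ext_split (M N1 N2 : amod A) (U1 U U' : {vspace M}) :
  submodule U -> submodule U' -> (U <= U')%VS ->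
  subquotient_iso U U1 N1 -> subquotient_iso U' U N2 -> Ext1_eq0 N2 N1 ->
  exists V : {vspace M}, [/\ submodule V, (V <= U')%VS, (V :&: U)%VS = U1,
    (V + U)%VS = U' & subquotient_iso V U1 N2].
Proof.
move=> hU hU' UU' [f1 [f1h f1U f1W]] [f2 [f2h f2U f2W]].
exact: (ext_split_aux hU hU' UU' f1h f2h f1U f1W f2U f2W).
Qed.

End Modules.

(** * Filtrations with prescribed sections *)

Section Filtrations.
Variables (K : fieldType) (A : finalg K) (L : Type) (N : L -> amod A).

(* [filtered P W U]: the subquotient U / W of the ambient module has a finite
   filtration whose sections are modules N l with P l. *)
Inductive filtered (M : amod A) (P : L -> Prop) (W : {vspace M}) :
    {vspace M} -> Prop :=
| filtered_refl : filtered P W W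
| filtered_step U U' l : filtered P W U -> submodule U' -> (U <= U')%VS ->
    P l -> subquotient_iso U' U (N l) -> filtered P W U'.

Section Ambient.
Variable M : amod A.
Implicit Types (P Q : L -> Prop) (U V W T : {vspace M}).

Lemma filtered_submodule P W U : submodule W -> filtered P W U -> submodule U.
Proof. by move=> hW; case. Qed.

Lemma filtered_weaken P Q W U :
  (forall l, P l -> Q l) -> filtered P W U -> filtered Q W U.
Proof.
move=> PQ; elim=> [|U0 U' l _ IH hU' UU' /PQ Ql iso]; first exact: filtered_refl.
exact: filtered_step IH hU' UU' Ql iso.
Qed.

Lemma filtered_trans P V W U :
  filtered P W V -> filtered P V U -> filtered P W U.
Proof.
move=> WV; elim=> [//|U0 U' l _ IH hU' UU' Pl iso].
exact: filtered_step IH hU' UU' Pl iso.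
Qed.

(** The section N l at the top moves down past the others one at a time: [ext_split] gives V1 above
    U1 with V1 / U1 isomorphic to N l, and the induction hypothesis applies to V1. *)
Lemma filtered_split P W U U' l :
  submodule W -> filtered P W U -> submodule U' -> (U <= U')%VS ->
  subquotient_iso U' U (N l) ->
  (forall k, P k -> Ext1_eq0 (N l) (N k)) ->
  exists V : {vspace M}, [/\ submodule V, (V <= U')%VS, (V :&: U)%VS = W,
    (V + U)%VS = U' & subquotient_iso V W (N l)].
Proof.
move=> hW fU; elim: fU U' => [|U1 U0 k fU1 IH hU U1U Pk iso1] U' hU' UU' iso ext.
  exists U'; split=> //; first by rewrite (capv_idPr UU').
  exact: (addv_idPl UU').
have [V1 [hV1 V1U' V1U V1UE isoV1]] := ext_split hU hU' UU' iso1 iso (ext _ Pk).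
have U1V1 : (U1 <= V1)%VS by rewrite -V1U capvSl.
have [V [hV VV1 VU1 VU1E isoV]] := IH V1 hV1 U1V1 isoV1 ext.
exists V; split=> //; first exact: subv_trans V1U'.
  by rewrite -(capv_idPl VV1) -capvA V1U.
by rewrite -{1}(addv_idPr U1U) addvA VU1E.
Qed.

(* Every section is either a split one, killed by J, or one on which J acts
   by the identity: so every x is congruent, modulo T, to an element that J
   maps into W. *)
Lemma filtered_kernel P Q (J : {pred A}) W U0 T U :
  submodule W -> filtered P W U0 -> (U0 <= T)%VS -> filtered Q U0 U ->
  (forall l, Q l -> P l) ->
  (forall a x, a \in J -> mact a x \in T) ->
  (forall l, Q l ->
     ((forall k, P k -> Ext1_eq0 (N l) (N k)) /\
      (forall a (z : N l), a \in J -> mact a z = 0)) \/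
     exists2 e, e \in J & forall z : N l, mact e z = z) ->
  forall x, x \in U -> exists y, [/\ y \in U, x - y \in T &
    forall a, a \in J -> mact a y \in W].
Proof.
move=> hW WU0 U0T fU QP JT sec; elim: fU => [|U1 U' l fU1 IH hU' U1U' Ql iso] x xU.
  exists 0; rewrite subr0 mem0v (subvP U0T) //; split=> // a _.
  by rewrite mactr0 mem0v.
have fU1' : filtered P W U1 by apply: filtered_trans WU0 (filtered_weaken QP fU1).
case: (sec l Ql) => [[ext kill] | [e eJ eN]].
  (* J kills the section, so it maps V into both V and U1, hence into W; the component v of x can be
     kept in y. *)
  have [V [hV VU' VU VUE _]] := filtered_split hW fU1' hU' U1U' iso ext.
  move: xU; rewrite -VUE => /memv_addP[v vV [u uU ->]].
  have [y [yU uyT Jy]] := IH u uU.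
  have [f [fh fU fW]] := iso.
  have [_ fk _] := subquotient_isoP fU fW.
  exists (v + y); split.
  - exact: memv_add.
  - by rewrite opprD addrACA subrr add0r.
  move=> a aJ; rewrite mactrD memvD ?Jy // -VU memv_cap hV //=.
  have vU' : v \in U' by apply: (subvP VU').
  by apply: fk; rewrite ?hU' // fh // kill.
have [f [fh fU fW]] := iso.
have [_ fk _] := subquotient_isoP fU fW.
(* Passing from x to x - e x changes x only modulo T and goes down one step of the filtration. *)
have uU : x - mact e x \in U1.
  by apply: fk; rewrite ?memvB ?hU' // linearB /= fh // eN subrr.
have [y [yU uyT Jy]] := IH _ uU.
exists y; split=> //; first exact: (subvP U1U').
have -> : x - y = mact e x + (x - mact e x - y).
  by rewrite addrA [mact e x + _]addrC subrK.
by rewrite memvD ?JT.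
Qed.

(** Each action of e descends one section, and e x = e (e x) lets the descent continue down to W. *)
Lemma idempotent_filtered P W U e :
  submodule W -> filtered P W U ->
  (forall x : M, mact e (mact e x) = mact e x) ->
  (forall l, P l -> forall z : N l, mact e z = 0) ->
  forall x, x \in U -> mact e x \in W.
Proof.
move=> hW fU ee kill; elim: fU => [|U1 U' l fU1 IH hU' U1U' Pl iso] x xU.
  exact: hW.
have [f [fh fU fW]] := iso.
have [_ fk _] := subquotient_isoP fU fW.
by rewrite -ee; apply: IH; apply: fk; rewrite ?hU' // fh // kill.
Qed.

End Ambient.
End Filtrations.

(** The filtration of each restricted section is pulled back along the map that identifies the
    section; these preimages refine the given filtration. *)
Lemma filtered_comp (K : fieldType) (A B : finalg K) (f : alghom A B)
    (L : Type) (NB : L -> amod B) (NA : L -> amod A) (M : amod B)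
    (P Q : L -> Prop) (W U : {vspace M}) :
  submodule W ->
  (forall l, P l -> filtered (M := Res f (NB l)) NA Q 0%VS fullv) ->
  filtered NB P W U ->
  filtered (M := Res f M) NA Q W U.
Proof.
move=> hW PQ; elim=> [|U1 U' l fU1 IH hU' U1U' Pl iso]; first exact: filtered_refl.
have hU1 := filtered_submodule hW fU1.
have [g [gh gU gW]] := iso.
have [gs gk gk'] := subquotient_isoP gU gW.
have step V : filtered (M := Res f (NB l)) NA Q 0%VS V ->
  submodule (M := Res f (NB l)) V ->
  filtered (M := Res f M) NA Q U1 (U' :&: (g @^-1: V))%VS.
  elim=> [|V0 V' k fV0 IHV hV' V0V' Qk [h [hh hF hW']]] hV.
    have -> : (U' :&: (g @^-1: 0))%VS = U1.
      by rewrite -gW; apply/vspaceP=> x; rewrite !memv_cap -memv_preim memv0 memv_ker.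
    exact: filtered_refl.
  have hV0 : submodule (M := Res f (NB l)) V0.
    by apply: filtered_submodule fV0; apply: submodule0.
  have [hs hk hk'] := subquotient_isoP hF hW'.
  apply: (filtered_step (IHV hV0) _ _ Qk).
  - move=> a x; rewrite !memv_cap -!memv_preim => /andP[xU xV].
    apply/andP; split; first exact: hU'.
    by rewrite [g _]gh //; apply: hV'.
  - apply: capvS (subvv _) _; apply/subvP=> x; rewrite -!memv_preim.
    exact: (subvP V0V').
  exists (h \o g)%VF; split.
  - move=> a x; rewrite memv_cap -memv_preim => /andP[xU xV].
    by rewrite !comp_lfunE [g _]gh // [h _](hh a).
  - apply/vspaceP=> z; rewrite memvf; have [y yV <-] := hs z.
    have [x xU gx] := gs y; apply/memv_imgP; exists x.
      by rewrite memv_cap xU -memv_preim gx.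
    by rewrite comp_lfunE gx.
  apply/vspaceP=> x; rewrite !memv_cap -!memv_preim memv_ker comp_lfunE.
  apply/idP/idP=> [/andP[/andP[-> gxV] /eqP hgx]|/andP[-> gxV]].
    exact: hk.
  by have [-> ->] := hk' _ gxV; rewrite eqxx.
apply: filtered_trans IH _.
have -> : U' = (U' :&: (g @^-1: fullv))%VS.
  by apply/vspaceP=> x; rewrite memv_cap -memv_preim memvf andbT.
by apply: step; [apply: PQ | apply: submodule_full].
Qed.

(** * Sums of simple submodules *)

Section Semisimple.
Variables (K : fieldType) (A : finalg K) (M : amod A).

(** A simple S meets the sum of the submodules kept so far in 0 or in S: it is kept in the first
    case and redundant in the second. Directness is recorded as additivity of dimensions, the form
    given by [directvE]. *)
Lemma simple_subset_sum (s : seq {vspace M}) :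
  (forall S, S \in s -> simple_submodule S) ->
  exists t : seq {vspace M}, [/\ forall S, S \in t -> simple_submodule S,
    (\sum_(S <- t) S = \sum_(S <- s) S)%VS
    & \dim (\sum_(S <- t) S) = (\sum_(S <- t) \dim S)%N].
Proof.
elim: s => [_|S s IH simp]; first by exists [::]; rewrite !big_nil dimv0.
have [|t [tsimp tE tdim]] := IH; first by move=> T Ts; apply: simp; rewrite inE Ts orbT.
have simpS : simple_submodule S by apply: simp; rewrite mem_head.
have [hS S0 Smin] := simpS.
have ht : submodule (\sum_(T <- t) T)%VS.
  elim: t {tE tdim} tsimp => [|T t IHt] tsimp.
    by rewrite big_nil; apply: submodule0.
  rewrite big_cons; apply: submoduleD; first by case: (tsimp T (mem_head _ _)).
  by apply: IHt => T' T't; apply: tsimp; rewrite inE T't orbT.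
have [cap0|capS] := Smin _ (submoduleI hS ht) (capvSl _ _).
  exists (S :: t); split.
  - by move=> T; rewrite inE => /predU1P[->|/tsimp].
  - by rewrite !big_cons tE.
  - by rewrite !big_cons dimv_disjoint_sum // tdim.
exists t; split=> //; rewrite big_cons -tE; apply/esym/addv_idPr.
by rewrite -capS capvSr.
Qed.

Lemma semisimple_module_sum (s : seq {vspace M}) :
  (forall S, S \in s -> simple_submodule S) ->
  (\sum_(S <- s) S = fullv)%VS -> semisimple_module M.
Proof.
move=> /simple_subset_sum[t [tsimp <- tdim]] sE.
exists (size t), (fun i => nth 0%VS t i).
have tnthE : (\sum_(i < size t) nth 0%VS t i)%VS = (\sum_(S <- t) S)%VS.
  by rewrite (big_nth 0%VS) big_mkord.
split=> [i||]; first by apply: tsimp; rewrite mem_nth.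
  by rewrite directvE /= tnthE tdim (big_nth 0%VS) big_mkord.
by rewrite tnthE.
Qed.

End Semisimple.

Lemma seq_min_exists (d : Order.disp_t) (T : porderType d) (s : seq T) x :
  x \in s -> exists2 y, y \in s & forall z, z \in s -> ~~ (z < y)%O.
Proof.
elim: s x => [//|x0 s IH] x _.
case: (s =P [::]) => [->|/eqP].
  by exists x0; rewrite ?mem_head // => z; rewrite inE => /eqP->; rewrite ltxx.
case: s IH => // x1 s IH _; have [y ys ymin] := IH x1 (mem_head _ _).
have [lt|nlt] := boolP (x0 < y)%O.
  exists x0; rewrite ?mem_head // => z.
  rewrite in_cons => /predU1P[->|zs]; first by rewrite ltxx.
  by apply: contra (ymin z zs) => /lt_trans; apply.
by exists y => [|z]; rewrite in_cons ?ys ?orbT // => /predU1P[->|/ymin].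
Qed.

(** * Cellular categories *)

Section Cellular.
Variables (K : fieldType) (Ob : Type) (C : lincat K Ob) (c : cellular C).
Implicit Types (D : {pred Lam c}) (m n p q : Ob) (l : Lam c).

(* l belongs to Lambda_n; unlike [LamZ], for an arbitrary type of objects. *)
Definition inh n l := (0 < #|cell_M n l|)%N.

Lemma inh_intro n l (S : cell_M n l) : inh n l.
Proof. by apply/card_gt0P; exists S. Qed.

Lemma comp0r p m n (a : hom C p m) : comp a (0 : hom C m n) = 0.
Proof. exact: (bilinr0 (comp_bilin C p m n)). Qed.

Lemma comp0l p m n (x : hom C m n) : comp (0 : hom C p m) x = 0.
Proof. exact: (bilinl0 (comp_bilin C p m n)). Qed.

Lemma compBr p m n (a : hom C p m) (x y : hom C m n) :
  comp a (x - y) = comp a x - comp a y.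
Proof. exact: (bilinrB (comp_bilin C p m n)). Qed.

Lemma compBl p m n (a b : hom C p m) (x : hom C m n) :
  comp (a - b) x = comp a x - comp b x.
Proof. exact: (bilinlB (comp_bilin C p m n)). Qed.

Lemma compDr p m n (a : hom C p m) (x y : hom C m n) :
  comp a (x + y) = comp a x + comp a y.
Proof. exact: (bilinrD (comp_bilin C p m n)). Qed.

Lemma compDl p m n (a b : hom C p m) (x : hom C m n) :
  comp (a + b) x = comp a x + comp b x.
Proof. exact: (bilinlD (comp_bilin C p m n)). Qed.

Lemma compZr p m n k (a : hom C p m) (x : hom C m n) :
  comp a (k *: x) = k *: comp a x.
Proof. exact: (bilinrZ (comp_bilin C p m n)). Qed.

Lemma compZl p m n k (a : hom C p m) (x : hom C m n) :
  comp (k *: a) x = k *: comp a x.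
Proof. exact: (bilinlZ (comp_bilin C p m n)). Qed.

Lemma comp_sumr p m n (a : hom C p m) I (r : seq I) (F : I -> hom C m n) :
  comp a (\sum_(i <- r) F i) = \sum_(i <- r) comp a (F i).
Proof. exact: (bilinr_sum (comp_bilin C p m n)). Qed.

Lemma comp_suml p m n I (r : seq I) (F : I -> hom C p m) (x : hom C m n) :
  comp (\sum_(i <- r) F i) x = \sum_(i <- r) comp (F i) x.
Proof. exact: (bilinl_sum (comp_bilin C p m n)). Qed.

Section Star.
Variables m n : Ob.

Let star_lin : {linear hom C m n -> hom C n m} :=
  HB.pack (@star _ _ _ c m n) (GRing.isLinear.Build _ _ _ _ _ (@star_linear _ _ _ c m n)).

Lemma star0 : star c (0 : hom C m n) = 0.
Proof. exact: (linear0 star_lin). Qed.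

Lemma starB (x y : hom C m n) : star c (x - y) = star c x - star c y.
Proof. exact: (linearB star_lin). Qed.

Lemma starZ k (x : hom C m n) : star c (k *: x) = k *: star c x.
Proof. exact: (linearZ_LR star_lin). Qed.

Lemma star_sum I (r : seq I) (F : I -> hom C m n) :
  star c (\sum_(i <- r) F i) = \sum_(i <- r) star c (F i).
Proof. exact: (linear_sum star_lin). Qed.

Lemma star_span (U : {vspace hom C n m}) (s : seq (hom C m n)) :
  (forall x, x \in s -> star c x \in U) ->
  forall x, x \in <<s>>%VS -> star c x \in U.
Proof.
move=> sU x; rewrite -[star c x]/(star_lin x) -(lfunE star_lin) memv_preim.
by move: x; apply/subvP/span_subvP=> x xs; rewrite -memv_preim lfunE sU.
Qed.

End Star.

Definition hom_mod m n : amod (endalg C m) :=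
  @AMod K (endalg C m) (hom C m n) (fun a x => comp a x) (comp_bilin C m m n)
    (fun a b x => esym (compA a b x)) (@comp1m _ _ C m n).

Definition cell_label m n l (S : cell_M m l) (T : cell_M n l) :
    {l : Lam c & (cell_M m l * cell_M n l)%type} :=
  Tagged (fun l => (cell_M m l * cell_M n l)%type) (S, T).

Definition cell_seq m n : seq (hom C m n) :=
  projT1 (cid (cell_basis c m n).2).

Lemma cell_seq_basis m n : basis_of fullv (cell_seq m n).
Proof. by rewrite /cell_seq; case: cid => B []. Qed.

Lemma cell_seqP m n x : x \in cell_seq m n <-> exists i, @cell_ix _ _ _ c m n i = x.
Proof. by rewrite /cell_seq; case: cid => B []. Qed.

(** The space A_D, for arbitrary objects m and n. Filtering the finite basis avoids a sum over
    Lambda, which may be infinite. *)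
Definition cell_span D m n : {vspace hom C m n} :=
  <<[seq x <- cell_seq m n |
      `[< exists l (S : cell_M m l) (T : cell_M n l),
            l \in D /\ x = cell_C c S T >]]>>%VS.

Lemma mem_cell_span D m n l (S : cell_M m l) (T : cell_M n l) :
  l \in D -> cell_C c S T \in cell_span D m n.
Proof.
move=> lD; apply: memv_span; rewrite mem_filter; apply/andP; split.
  by apply/asboolP; exists l, S, T.
by apply/cell_seqP; exists (cell_label S T).
Qed.

Lemma cell_span_sub D m n (U : {vspace hom C m n}) :
  (forall l (S : cell_M m l) (T : cell_M n l), l \in D -> cell_C c S T \in U) ->
  (cell_span D m n <= U)%VS.
Proof.
move=> DU; apply/span_subvP=> x; rewrite mem_filter => /andP[/asboolP].
by move=> [l [S [T [lD ->]]]] _; apply: DU.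
Qed.

Lemma cell_span_mono D D' m n :
  (forall l, l \in D -> inh m l -> inh n l -> l \in D') ->
  (cell_span D m n <= cell_span D' m n)%VS.
Proof.
move=> DD'; apply: cell_span_sub => l S T lD; apply: mem_cell_span.
by apply: DD' => //; [apply: inh_intro S | apply: inh_intro T].
Qed.

Lemma cell_span_full D m n :
  (forall l, inh m l -> inh n l -> l \in D) -> cell_span D m n = fullv.
Proof.
move=> DT; apply/eqP; rewrite eqEsubv subvf /=.
rewrite -(span_basis (cell_seq_basis m n)); apply/span_subvP=> x /cell_seqP[[l [S T]] <-].
by apply/mem_cell_span/DT; [apply: inh_intro S | apply: inh_intro T].
Qed.

Lemma cell_span0 D m n :
  (forall l, inh m l -> inh n l -> l \notin D) -> cell_span D m n = 0%VS.
Proof.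
move=> DT; apply/eqP; rewrite -subv0; apply: cell_span_sub => l S T lD.
by have := DT l (inh_intro S) (inh_intro T); rewrite lD.
Qed.

Definition cell_crd m n l (S : cell_M m l) (T : cell_M n l) : 'Hom(hom C m n, K^o) :=
  linfun (projT1 (cid (cell_coord (c := c) (cell_label S T)))).

Lemma cell_crdE m n l (S S' : cell_M m l) (T T' : cell_M n l) :
  cell_crd S T (cell_C c S' T') = ((S' == S) && (T' == T))%:R.
Proof.
rewrite lfunE; case: cid => phi phiE /=.
have := phiE (cell_label S' T').
by rewrite /cell_ix /= -tag_eqE /tag_eq eqxx tagged_asE.
Qed.

Lemma cell_crd_neq m n l l' (S : cell_M m l) (T : cell_M n l)
    (S' : cell_M m l') (T' : cell_M n l') :
  l' != l -> cell_crd S T (cell_C c S' T') = 0.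
Proof.
rewrite lfunE; case: cid => phi phiE /= ne.
have := phiE (cell_label S' T').
by rewrite /cell_ix /= -tag_eqE /tag_eq /= (negPf ne).
Qed.

Lemma cell_crd_span D m n l (S : cell_M m l) (T : cell_M n l) x :
  l \notin D -> x \in cell_span D m n -> cell_crd S T x = 0.
Proof.
move=> lD; suff: (cell_span D m n <= lker (cell_crd S T))%VS.
  by move/subvP=> h /h; rewrite memv_ker => /eqP.
apply: cell_span_sub => l' S' T' lD'; rewrite memv_ker cell_crd_neq //.
by apply: contraNneq lD => <-.
Qed.

(* Lower-closedness only among the labels that occur in Hom(m, n). *)
Definition lower D m n := forall l' l,
  (l' < l)%O -> l \in D -> inh m l' -> inh n l' -> l' \in D.

Lemma below_span D m n l x :
  (forall l', (l' < l)%O -> inh m l' -> inh n l' -> l' \in D) ->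
  in_span (@below _ _ _ c l m n) x -> x \in cell_span D m n.
Proof.
move=> bD [s [sb xs]]; have /span_subvP/subvP : {subset s <= cell_span D m n}; last exact.
move=> y /sb[l' [S [T [lt ->]]]]; apply/mem_cell_span/bD => //.
  exact: inh_intro S.
exact: inh_intro T.
Qed.

Lemma cell_mul_span D p m n l (a : hom C p m) (S : cell_M m l) (T : cell_M n l) :
  (forall l', (l' < l)%O -> inh p l' -> inh n l' -> l' \in D) ->
  comp a (cell_C c S T) - \sum_S' cell_r c a S' S *: cell_C c S' T
    \in cell_span D p n.
Proof.
move=> bD; apply: below_span bD _; have [s [Ps xs]] := cell_mul a S T.
by exists s.
Qed.

(** The error term of (C3) has only labels below l, hence no coordinate at l. Questions on cell
    modules thus become questions on coordinates of products of morphisms. *)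
Lemma cell_r_crd p m n l (a : hom C p m) (S : cell_M m l) (T : cell_M n l) S' :
  cell_r c a S' S = cell_crd S' T (comp a (cell_C c S T)).
Proof.
have := @cell_mul_span [pred l' | (l' < l)%O] _ _ _ _ a S T (fun _ h _ _ => h).
move/(cell_crd_span S' T); rewrite inE ltxx => /(_ isT) /eqP.
rewrite linearB subr_eq0 => /eqP->; rewrite linear_sum (bigD1 S') //=.
rewrite linearZ /= cell_crdE !eqxx big1 ?addr0 => [|S2 ne].
  by rewrite [_ *: _]mulr1.
by rewrite linearZ /= cell_crdE (negPf ne) [_ *: _]mulr0.
Qed.

Lemma cell_span_compl D p m n (a : hom C p m) x :
  lower D p n -> x \in cell_span D m n -> comp a x \in cell_span D p n.
Proof.
move=> lowD; have [f fE] := bilin_homr (comp_bilin C p m n) a.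
rewrite -fE memv_preim; apply/subvP/cell_span_sub => l S T lD {x}.
rewrite -memv_preim fE -[comp _ _](subrK (\sum_S' cell_r c a S' S *: cell_C c S' T)).
apply: memvD; first by apply: cell_mul_span => l' lt; apply: lowD lt lD.
by apply: memv_suml => S' _; apply/memvZ/mem_cell_span.
Qed.

Lemma cell_span_star D m n x : x \in cell_span D m n -> star c x \in cell_span D n m.
Proof.
apply: star_span => {}x; rewrite mem_filter => /andP[/asboolP[l [S [T [lD ->]]]] _].
by rewrite cell_star mem_cell_span.
Qed.

Lemma cell_span_compr D m n q (x : hom C m n) (b : hom C n q) :
  lower D m q -> x \in cell_span D m n -> comp x b \in cell_span D m q.
Proof.
move=> lowD xD; rewrite -[comp _ _](starK c) star_comp; apply: cell_span_star.
apply: cell_span_compl; last exact: cell_span_star.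
by move=> l' l lt lD i1 i2; apply: lowD lt lD i2 i1.
Qed.

Lemma cell_span_submodule D m n :
  lower D m n -> submodule (cell_span D m n : {vspace hom_mod m n}).
Proof. by move=> lowD a x; apply: cell_span_compl. Qed.

(** The matrix entries of a on Delta_n(l) are coordinates at l of elements of A_D, by
    [cell_r_crd]. *)
Lemma cell_span_kill D n l (a : endalg C n) (z : Delta n l) :
  lower D n n -> a \in cell_span D n n -> l \notin D -> mact a z = 0.
Proof.
move=> lowD aD lD; apply/ffunP=> Y; rewrite !ffunE big1 // => X _.
rewrite (cell_r_crd a X X) (cell_crd_span _ _ lD) ?mul0r //.
exact: cell_span_compr.
Qed.

Lemma cell_span_add D m n l x :
  x \in cell_span [predU1 l & D] m n ->
  x - \sum_(S : cell_M m l) \sum_(T : cell_M n l)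
        cell_crd S T x *: cell_C c S T \in cell_span D m n.
Proof.
(* The double sum is a linear function g of x, so the claim can be checked on generators. *)
pose g : 'Hom(hom C m n, hom C m n) := \sum_(S : cell_M m l) \sum_(T : cell_M n l)
  rank1 (cell_crd S T) (cell_C c S T).
have gE y : g y = \sum_(S : cell_M m l) \sum_(T : cell_M n l)
    cell_crd S T y *: cell_C c S T.
  rewrite sum_lfunE; apply: eq_bigr => S _; rewrite sum_lfunE.
  by apply: eq_bigr => T _; apply: rank1E.
rewrite -gE.
have -> : x - g x = (\1 - g)%VF x.
  by rewrite add_lfunE opp_lfunE id_lfunE.
rewrite memv_preim; move: x; apply/subvP/cell_span_sub => l' S' T' l'D.
rewrite -memv_preim add_lfunE opp_lfunE id_lfunE gE.
have [e|ne] := eqVneq l' l; last first.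
  rewrite big1 ?subr0 => [|S _]; last first.
    by rewrite big1 // => T _; rewrite cell_crd_neq ?scale0r.
  by apply: mem_cell_span; move: l'D; rewrite inE (negPf ne).
subst l'; rewrite (bigD1 S') //= (bigD1 T') //= cell_crdE !eqxx scale1r.
rewrite !big1 ?addr0 ?subrr ?mem0v // => [S ne|T ne].
  by rewrite big1 // => T _; rewrite cell_crdE eq_sym (negPf ne) scale0r.
by rewrite cell_crdE eqxx eq_sym (negPf ne) scale0r.
Qed.

End Cellular.

(** * Chains of lower sets and filtrations by cell modules *)

Section CellChains.
Variables (K : fieldType) (Ob : Type) (C : lincat K Ob) (c : cellular C).
Implicit Types (D : {pred Lam c}) (m n p q : Ob) (l : Lam c).

Lemma cell_span_addP D m n l (U : {vspace hom C m n}) :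
  (cell_span D m n <= U)%VS ->
  (forall (S : cell_M m l) (T : cell_M n l), cell_C c S T \in U) ->
  (cell_span [predU1 l & D] m n <= U)%VS.
Proof.
move=> DU lU; apply: cell_span_sub => l' S T; rewrite inE => /predU1P[e|l'D].
  by subst l'.
exact/(subvP DU)/mem_cell_span.
Qed.

(** Lambda may be infinite, but each of the finitely many elements of the cellular basis carries a
    single label, by injectivity. *)
Lemma cell_labels_finite m n :
  exists s : seq (Lam c), forall l, inh m l -> inh n l -> l \in s.
Proof.
suff [s sP] : exists s : seq (Lam c), forall i,
    @cell_ix _ _ _ c m n i \in cell_seq c m n -> tag i \in s.
  exists s => l /card_gt0P[S _] /card_gt0P[T _]; apply: (sP (cell_label S T)).
  by apply/cell_seqP; exists (cell_label S T).
elim: (cell_seq c m n) => [|b B [s sP]]; first by exists [::].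
have [[i iE]|nb] := pselect (exists i, @cell_ix _ _ _ c m n i = b).
  exists (tag i :: s) => j; rewrite !inE => /predU1P[|/sP->]; last by rewrite orbT.
  by rewrite -iE => /(cell_basis c m n).1 ->; rewrite eqxx.
exists s => j; rewrite inE => /predU1P[e|/sP //].
by case: nb; exists j.
Qed.

(* Induction along a linear extension of the order on the labels in D1 \ D0. *)
Lemma cell_chain m n D0 D1 (Q : {pred Lam c} -> Prop) :
  lower D0 m n -> lower D1 m n -> {subset D0 <= D1} -> Q D0 ->
  (forall D l, lower D m n -> {subset D0 <= D} -> {subset D <= D1} ->
     l \in D1 -> l \notin D -> inh m l -> inh n l ->
     (forall l', (l' < l)%O -> inh m l' -> inh n l' -> l' \in D) ->
     lower [predU1 l & D] m n -> Q D -> Q [predU1 l & D]) ->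
  exists D, [/\ Q D, lower D m n, {subset D <= D1}
    & forall l, l \in D1 -> inh m l -> inh n l -> l \in D].
Proof.
move=> low0 low1 D01 Q0 step; have [s sP] := cell_labels_finite m n.
(* [cand D] lists the labels still missing from D; its size drives the induction. *)
pose cand D := [seq l <- s | [&& l \in D1, l \notin D, inh m l & inh n l]].
have candP D l : (l \in cand D) = [&& l \in D1, l \notin D, inh m l & inh n l].
  rewrite mem_filter; apply: andb_idr => /and4P[_ _ im iN]; exact: sP.
suff H k D : (size (cand D) <= k)%N -> lower D m n -> {subset D0 <= D} ->
    {subset D <= D1} -> Q D ->
    exists D, [/\ Q D, lower D m n, {subset D <= D1}
      & forall l, l \in D1 -> inh m l -> inh n l -> l \in D].
  exact: (H _ D0 (leqnn _)).
elim: k D => [|k IH] D szD lowD D0D DD1 QD.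
  exists D; split=> // l lD1 im iN; apply/negPn/negP=> lD.
  have : l \in cand D by rewrite candP lD1 lD im.
  by move: szD; rewrite leqn0 => /nilP->.
have [e|[l0 l0c]] : cand D = [::] \/ exists l, l \in cand D.
  by case: (cand D) => [|l s']; [left | right; exists l; rewrite mem_head].
  by apply: (IH D); rewrite ?e.
(* Adding a minimal missing label keeps the set lower. *)
have [l lc lmin] := seq_min_exists l0c.
have := lc; rewrite candP => /and4P[lD1 lD im iN].
have belowD l' : (l' < l)%O -> inh m l' -> inh n l' -> l' \in D.
  move=> lt im' iN'; apply/negPn/negP=> l'D; have := lmin l'.
  rewrite lt candP l'D im' iN'.
  by rewrite (low1 _ _ lt lD1) // => /(_ isT).
have lowl : lower [predU1 l & D] m n.
  move=> l1 l2 lt; rewrite !inE => /predU1P[e|l2D] i1 i2.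
    by rewrite belowD ?orbT // -e.
  by rewrite (lowD _ _ lt l2D) ?orbT.
have DlD : {subset D <= [predU1 l & D]} by move=> x xD; rewrite inE xD orbT.
apply: (IH _ _ lowl).
- have -> : cand [predU1 l & D] = [seq x <- cand D | x != l].
    rewrite -filter_predI; apply: eq_filter => x /=; rewrite inE negb_or.
    by case: (x == l); rewrite //= andbF.
  have : (0 < count_mem l (cand D))%N by rewrite -has_count has_pred1.
  move: szD; rewrite -(count_predC (pred1 l)) size_filter.
  case: (count_mem l _) => // j; rewrite addSn ltnS => h _.
  exact: leq_trans (leq_addl _ _) h.
- by move=> x /D0D /DlD.
- by move=> x; rewrite inE => /predU1P[->|/DD1].
- by apply: step.
Qed.

Lemma cell_span_eq D D' m n :
  (forall l, l \in D -> inh m l -> inh n l -> l \in D') ->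
  (forall l, l \in D' -> inh m l -> inh n l -> l \in D) ->
  cell_span D m n = cell_span D' m n.
Proof. by move=> DD' D'D; apply/eqP; rewrite eqEsubv !cell_span_mono. Qed.

(* One section Delta_m(l) for each T in M(n, l). *)
Lemma cell_span_add_filtered D m n l (P : Lam c -> Prop) :
  lower D m n -> l \notin D -> P l ->
  (forall l', (l' < l)%O -> inh m l' -> inh n l' -> l' \in D) ->
  filtered (M := hom_mod C m n) (Delta m) P (cell_span D m n)
    (cell_span [predU1 l & D] m n).
Proof.
move=> lowD lD Pl bD.
(* The columns C_(-,T) are added one T at a time, t being the list of those already present. *)
pose U (t : seq (cell_M n l)) : {vspace hom C m n} :=
  (cell_span D m n + <<[seq cell_C c X T | X <- enum (cell_M m l), T <- t]>>)%VS.
have memU t (S : cell_M m l) T : T \in t -> cell_C c S T \in U t.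
  move=> Tt; apply: (subvP (addvSr _ _)); apply: memv_span.
  by apply/allpairsP; exists (S, T); rewrite mem_enum.
have subU t (W : {vspace hom C m n}) : (cell_span D m n <= W)%VS ->
    (forall (S : cell_M m l) T, T \in t -> cell_C c S T \in W) -> (U t <= W)%VS.
  move=> DW tW; rewrite subv_add DW; apply/span_subvP=> x.
  by case/allpairsP=> [[S T] [_ Tt ->]]; apply: tW.
have hU t : submodule (U t : {vspace hom_mod C m n}).
  move=> a x; rewrite -[mact a x]/(comp a x).
  have [f fE] := bilin_homr (comp_bilin C m m n) a; rewrite -fE memv_preim.
  move: x; apply/subvP/subU => [|S T Tt].
    apply/subvP=> x xD; rewrite -memv_preim fE; apply: (subvP (addvSl _ _)).
    exact: cell_span_compl.
  rewrite -memv_preim fE -[comp _ _](subrK (\sum_S' cell_r c a S' S *: cell_C c S' T)).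
  apply: memvD; first by apply: (subvP (addvSl _ _)); apply: cell_mul_span.
  by apply: memv_suml => S' _; apply/memvZ/memU.
have -> : cell_span [predU1 l & D] m n = U (enum (cell_M n l)).
  apply/eqP; rewrite eqEsubv cell_span_addP /=.
  - apply: subU => [|S T _]; last by rewrite mem_cell_span // inE eqxx.
    by apply: cell_span_mono => l' l'D _ _; rewrite inE l'D orbT.
  - exact: addvSl.
  by move=> S T; rewrite memU ?mem_enum.
have U0 : U [::] = cell_span D m n.
  apply/eqP; rewrite eqEsubv addvSl andbT; apply: subU => //.
elim: (enum _) (enum_uniq (cell_M n l)) => [|T t IH].
  by rewrite U0 => _; apply: filtered_refl.
case/andP=> Tt /IH ft.
have UT : (U t <= U (T :: t))%VS.
  by apply: subU => [|S T' T't]; rewrite ?addvSl // memU // inE T't orbT.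
apply: (filtered_step ft (hU _) UT Pl).
(* The coordinates along the column T identify the new section with Delta_m(l). *)
pose f0 (x : hom C m n) : Delta m l := [ffun S => cell_crd S T x].
have f0_lin : linear f0.
  by move=> k x y; apply/ffunP=> S; rewrite !ffunE linearP.
pose f : 'Hom(hom C m n, Delta m l) :=
  linfun (HB.pack f0 (GRing.isLinear.Build _ _ _ _ _ f0_lin) : {linear _ -> _}).
have fE x S : (f x : {ffun _ -> K^o}) S = cell_crd S T x by rewrite lfunE ffunE.
have f_t x : x \in U t -> f x = 0.
  suff: (U t <= lker f)%VS by move/subvP=> h /h; rewrite memv_ker => /eqP.
  apply: subU => [|S T' T't].
    apply/subvP=> y yD; rewrite memv_ker; apply/eqP/ffunP=> S.
    by rewrite fE (cell_crd_span _ _ lD yD) ffunE.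
  rewrite memv_ker; apply/eqP/ffunP=> S'; rewrite fE cell_crdE ffunE.
  by case: (T' =P T) T't Tt => [-> ->|_]; rewrite // andbF.
have fT S : f (cell_C c S T) = [ffun S' => (S == S')%:R].
  by apply/ffunP=> S'; rewrite fE cell_crdE !ffunE eqxx andbT.
exists f; split.
- move=> a x xU.
  have [La LaE] := bilin_homr (comp_bilin C m m n) a.
  have [Ld LdE] := bilin_homr (mact_bilin (Delta m l)) a.
  suff: (U (T :: t) <= lker ((f \o La)%VF - (Ld \o f)%VF))%VS.
    move/subvP=> /(_ x xU); rewrite memv_ker add_lfunE opp_lfunE !comp_lfunE.
    by rewrite LaE LdE subr_eq0 => /eqP.
  have ker_t y : y \in U t -> y \in lker ((f \o La)%VF - (Ld \o f)%VF).
    move=> yU; rewrite memv_ker add_lfunE opp_lfunE !comp_lfunE LaE LdE.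
    by rewrite (f_t _ yU) (f_t _ (hU t a y yU)) mactr0 subrr.
  apply: subU => [|S T']; first by apply/subvP=> y yD; apply/ker_t/(subvP (addvSl _ _)).
  rewrite inE => /predU1P[->|T't]; last exact/ker_t/memU.
  rewrite memv_ker add_lfunE opp_lfunE !comp_lfunE LaE LdE subr_eq0.
  apply/eqP/ffunP=> S'; rewrite fE fT ffunE -cell_r_crd (bigD1 S) //= big1 => [|X ne].
    by rewrite ffunE eqxx mulr1 addr0.
  by rewrite ffunE eq_sym (negPf ne) mulr0.
- apply/vspaceP=> z; rewrite memvf; apply/memv_imgP.
  exists (\sum_S (z : {ffun _ -> K^o}) S *: cell_C c S T).
    by apply: memv_suml => S _; apply/memvZ/memU/mem_head.
  apply/ffunP=> S; rewrite fE linear_sum (bigD1 S) //= big1 => [|X ne].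
    by rewrite linearZ /= cell_crdE !eqxx addr0 [_ *: _]mulr1.
  by rewrite linearZ /= cell_crdE (negPf ne) [_ *: _]mulr0.
apply/vspaceP=> x; rewrite memv_cap memv_ker.
apply/andP/idP=> [[xU /eqP fx0]|xU]; last by rewrite (subvP UT) // (f_t _ xU).
(* g projects onto the column T, so 1 - g maps U (T :: t) into U t, and g vanishes on the kernel of
   f. *)
pose g : 'Hom(hom C m n, hom C m n) := \sum_S rank1 (cell_crd S T) (cell_C c S T).
have gE y : g y = \sum_S cell_crd S T y *: cell_C c S T.
  by rewrite sum_lfunE; apply: eq_bigr => S _; apply: rank1E.
suff: (U (T :: t) <= (\1 - g) @^-1: U t)%VS.
  move/subvP=> /(_ x xU); rewrite -memv_preim add_lfunE opp_lfunE id_lfunE gE.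
  by rewrite big1 ?subr0 // => S _; rewrite -fE fx0 ffunE scale0r.
have pre_t y : y \in U t -> y \in ((\1 - g) @^-1: U t)%VS.
  move=> yU; rewrite -memv_preim add_lfunE opp_lfunE id_lfunE gE.
  by rewrite big1 ?subr0 // => S _; rewrite -fE (f_t _ yU) ffunE scale0r.
apply: subU => [|S T']; first by apply/subvP=> y yD; apply/pre_t/(subvP (addvSl _ _)).
rewrite inE => /predU1P[->|T't]; last exact/pre_t/memU.
rewrite -memv_preim add_lfunE opp_lfunE id_lfunE gE (bigD1 S) //= big1.
  by rewrite cell_crdE !eqxx scale1r addr0 subrr mem0v.
by move=> X ne; rewrite cell_crdE eq_sym (negPf ne) scale0r.
Qed.

Lemma filtered_cell_span m n D0 D1 :
  lower D0 m n -> lower D1 m n -> {subset D0 <= D1} ->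
  filtered (M := hom_mod C m n) (Delta m)
    (fun l => [/\ l \in D1, l \notin D0, inh m l & inh n l])
    (cell_span D0 m n) (cell_span D1 m n).
Proof.
move=> low0 low1 D01; set P := fun l => _.
have [D [fD _ DD1 D1D]] := cell_chain (Q := fun D => filtered (M := hom_mod C m n)
    (Delta m) P (cell_span D0 m n) (cell_span D m n)) low0 low1 D01
    (filtered_refl _ _ _)
  (fun D l lowD D0D DD1 lD1 lD im iN bD lowl fD => filtered_trans fD
    (cell_span_add_filtered (P := P) lowD lD
      (And4 lD1 (contra (@D0D l) lD) im iN) bD)).
by rewrite -(@cell_span_eq D D1) // => l /DD1.
Qed.

End CellChains.

(** * Identities of the ideals A_D *)

Section CellUnits.
Variables (K : fieldType) (Ob : Type) (C : lincat K Ob) (c : cellular C).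
Implicit Types (D L : {pred Lam c}) (m n p q k : Ob) (l : Lam c).

Lemma lower_left D n m : lower D n n -> lower D n m.
Proof. by move=> lowD l' l lt lD i _; apply: (lowD _ _ lt lD). Qed.

Lemma lower_right D n m : lower D n n -> lower D m n.
Proof. by move=> lowD l' l lt lD _ i; apply: (lowD _ _ lt lD). Qed.

(* The bilinear form of the cell module: by [cell_r_form], any left index could
   replace V in the two places where it stands for one. *)
Definition cell_form m l (T V : cell_M m l) : K := cell_r c (cell_C c V V) V T.

(** (C3) describes left multiplication. Through the involution it shows that C_(S,T) C_(V,V) keeps
    its left index S modulo smaller labels, with a coefficient independent of S. *)
Lemma cell_r_form p m l (S S' : cell_M p l) (T V : cell_M m l) :
  cell_r c (cell_C c S T) S' V = (S' == S)%:R * cell_form T V.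
Proof.
rewrite (cell_r_crd _ _ V) -[comp _ _](starK c) star_comp !cell_star.
set x := comp _ _.
have mulD := @cell_mul_span _ _ _ c [pred l' | (l' < l)%O] _ _ _ _
  (cell_C c V V) T S (fun _ h _ _ => h).
have nD : l \notin [pred l' | (l' < l)%O] by rewrite inE ltxx.
have := cell_crd_span S' V nD (cell_span_star mulD); rewrite starB -/x => /eqP.
rewrite linearB subr_eq0 => /eqP->; rewrite star_sum linear_sum (bigD1 V) //=.
rewrite big1 => [|X ne].
  by rewrite starZ cell_star linearZ /= cell_crdE eqxx andbT addr0 eq_sym mulrC.
by rewrite starZ cell_star linearZ /= cell_crdE (negPf ne) andbF [_ *: _]mulr0.
Qed.

Lemma cell_mul_form D p m q l (S : cell_M p l) (T V : cell_M m l) (W : cell_M q l) :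
  (forall l', (l' < l)%O -> inh p l' -> inh q l' -> l' \in D) ->
  comp (cell_C c S T) (cell_C c V W) - cell_form T V *: cell_C c S W
    \in cell_span D p q.
Proof.
move=> bD; have := cell_mul_span (cell_C c S T) V W bD.
rewrite (bigD1 S) //= cell_r_form eqxx mul1r big1 ?addr0 // => X ne.
by rewrite cell_r_form (negPf ne) mul0r scale0r.
Qed.

(** On a chain from the intersection of D and L up to D, each added label lies outside L, so
    elements of A_L have no coordinates there. *)
Lemma cell_span_cap D L m n x : lower D m n -> lower L m n ->
  x \in cell_span D m n -> x \in cell_span L m n ->
  x \in cell_span [predI D & L] m n.
Proof.
move=> lowD lowL.
have lowDL : lower [predI D & L] m n.
  move=> l' l lt; rewrite !inE => /andP[lD lL] i j.
  by rewrite (lowD _ _ lt lD i j) (lowL _ _ lt lL i j).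
have [|||E [QE _ _ DE]] := cell_chain (Q := fun E => forall x, x \in cell_span E m n ->
    x \in cell_span L m n -> x \in cell_span [predI D & L] m n) lowDL lowD _ _ _.
- by move=> l /andP[].
- by [].
- move=> E l _ DLE ED lD lE _ _ _ _ IH y yE yL; apply: (IH) (yL).
  have lL : l \notin L.
    by apply: contra lE => lL; apply: DLE; rewrite inE lD.
  have := cell_span_add yE; rewrite big1 ?subr0 // => S _.
  by rewrite big1 // => T _; rewrite (cell_crd_span _ _ lL yL) scale0r.
by move=> xD xL; apply: QE xL; apply: (subvP (cell_span_mono _)) xD.
Qed.

Lemma cell_span_predU D L m n x :
  x \in cell_span [predU D & L] m n ->
  exists y z, [/\ y \in cell_span D m n, z \in cell_span L m n & x = y + z].
Proof.
have : (cell_span [predU D & L] m n <= cell_span D m n + cell_span L m n)%VS.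
  apply: cell_span_sub => l S T; rewrite inE => /orP[lD|lL].
    exact/(subvP (addvSl _ _))/mem_cell_span.
  exact/(subvP (addvSr _ _))/mem_cell_span.
move=> /subvP h /h /memv_addP[y yD [z zL ->]]; by exists y, z.
Qed.

Definition cell_unit D n (e : hom C n n) : Prop :=
  e \in cell_span D n n /\
  forall x, x \in cell_span D n n -> comp e x = x /\ comp x e = x.

Lemma cell_unit_star D n (e : hom C n n) : cell_unit D e -> star c e = e.
Proof.
move=> [eD eU]; have sD := cell_span_star eD.
have /(congr1 (fun x => star c x)) := (eU _ sD).1.
by rewrite star_comp !starK (eU _ sD).1.
Qed.

(** The involution turns a right identity into a left one, and the two coincide. *)
Lemma cell_unit_right D n (e : hom C n n) : e \in cell_span D n n ->
  (forall x, x \in cell_span D n n -> comp x e = x) -> cell_unit D e.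
Proof.
move=> eD eR; have sL x : x \in cell_span D n n -> comp (star c e) x = x.
  by move=> xD; rewrite -[x in LHS](starK c) -star_comp eR ?starK // cell_span_star.
have se : star c e = e.
  by rewrite -(eR _ (cell_span_star eD)) sL.
by split=> // x xD; split; [rewrite -se sL | apply: eR].
Qed.

Lemma cell_unit_complement D n (h : hom C n n) : idm n - h \in cell_span D n n ->
  (forall x, x \in cell_span D n n -> comp x h = 0) ->
  cell_unit D (idm n - h).
Proof.
move=> hD xh; apply: cell_unit_right => // x xD.
by rewrite compBr compm1 xh // subr0.
Qed.

Lemma cell_unit_Delta D n (e : hom C n n) l (z : Delta n l) :
  cell_unit D e -> l \in D -> mact (e : endalg C n) z = z.
Proof.
move=> [eD eU] lD; apply/ffunP=> Y; rewrite ffunE (bigD1 Y) //= big1 => [|X ne].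
  rewrite (cell_r_crd e Y Y) (eU _ (mem_cell_span _ _ lD)).1 cell_crdE !eqxx.
  by rewrite mul1r addr0.
rewrite (cell_r_crd e X X) (eU _ (mem_cell_span _ _ lD)).1 cell_crdE.
by rewrite (negPf ne) mul0r.
Qed.

(* 1 - e is idempotent and kills each section of a filtration of the span. *)
Lemma cell_unit_compl D n m (e : hom C n n) (x : hom C n m) :
  lower D n n -> cell_unit D e ->
  x \in cell_span D n m -> comp e x = x.
Proof.
move=> lowD eU xD.
have low0 : lower (pred0 : {pred Lam c}) n m by [].
have s0 : {subset (pred0 : {pred Lam c}) <= D} by [].
have fD := filtered_cell_span low0 (lower_left lowD) s0.
have sub0 : submodule (cell_span (pred0 : {pred Lam c}) n m : {vspace hom_mod C n m}).
  exact: cell_span_submodule.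
have ee : comp e e = e := (eU.2 _ eU.1).1.
have := idempotent_filtered (M := hom_mod C n m) (e := (idm n - e : endalg C n))
  sub0 fD _ _ xD.
rewrite cell_span0 // memv0 => h.
have /eqP : mact (idm n - e : endalg C n) (x : hom_mod C n m) == 0.
  apply: h => [y|l [lD _ _ _] z].
    by rewrite -mactM /= [comp (idm n - e) _]compBl comp1m compBr compm1 ee subrr subr0.
  by rewrite mactlB (mact1 z) (cell_unit_Delta _ eU lD) subrr.
by rewrite /= compBl comp1m => /eqP; rewrite subr_eq0 => /eqP.
Qed.

Lemma cell_unit_compr D n m (e : hom C n n) (x : hom C m n) :
  lower D n n -> cell_unit D e ->
  x \in cell_span D m n -> comp x e = x.
Proof.
move=> lowD eU xD; rewrite -[x in LHS](starK c) -{1}(cell_unit_star eU) -star_comp.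
by rewrite (cell_unit_compl lowD eU) ?starK // cell_span_star.
Qed.

(** Inclusion and exclusion: the identity for D is a - e + b. For x in A_D, the product x e lies in
    both A_D and A_L, hence x e = x e b = x b. *)
Lemma cell_unit_predUI D L n (a b e : hom C n n) : lower D n n -> lower L n n ->
  cell_unit L e -> cell_unit [predU D & L] a -> cell_unit [predI D & L] b ->
  exists f : hom C n n, cell_unit D f.
Proof.
move=> lowD lowL [eL eU] [aDL aU] [bDL bU].
have subU D' : (forall l, l \in D' -> l \in [predU D & L]) ->
    (cell_span D' n n <= cell_span [predU D & L] n n)%VS.
  by move=> h; apply: cell_span_mono => l /h.
exists (a - e + b); apply: cell_unit_right.
  apply: memvD; last first.
    by apply: (subvP (cell_span_mono _)) bDL => l /andP[].
  (* With a = y + z, y in A_D and z in A_L, one gets a - e = a - a e = y - y e. *)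
  have ae : comp a e = e.
    by apply: (aU _ _).1; apply: (subvP (subU _ _)) eL => l lL; rewrite inE /= lL orbT.
  rewrite -{1}ae; have [y [z [yD zL ->]]] := cell_span_predU aDL.
  rewrite compDl (eU _ zL).2 opprD addrACA subrr addr0 memvB //.
  exact: cell_span_compr.
move=> x xD; rewrite compDr compBr (aU _ _).2; last first.
  by apply: (subvP (subU _ _)) xD => l lD; rewrite inE /= lD.
have xeDL : comp x e \in cell_span [predI D & L] n n.
  by apply: cell_span_cap => //; [apply: cell_span_compr | apply: cell_span_compl].
have -> : comp x b = comp x e; last by rewrite subrK.
have bL : b \in cell_span L n n.
  by apply: (subvP (cell_span_mono _)) bDL => l /andP[].
by rewrite -(bU _ xeDL).2 -compA (eU _ bL).1.
Qed.

End CellUnits.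

(** * Transfer of identities from A_k to A_n *)

Section UnitTransfer.
Variables (K : fieldType) (Ob : Type) (C : lincat K Ob) (c : cellular C).
Variables (k n : Ob).
Let Lk : {pred Lam c} := fun l => inh k l.
Hypothesis kn : forall l : Lam c, inh k l -> inh n l.
Hypothesis units_k : forall D : {pred Lam c}, lower D k k ->
  exists e : hom C k k, cell_unit D e.

(** The ideal of sums of endomorphisms of n that factor through k. *)
Definition factor_span : {vspace hom C n n} :=
  <<[seq comp x y | x <- vbasis (fullv : {vspace hom C n k}),
                    y <- vbasis (fullv : {vspace hom C k n})]>>%VS.

Lemma mem_factor_span (x : hom C n k) (y : hom C k n) :
  comp x y \in factor_span.
Proof.
apply: (bilin_span (comp_bilin C n k n) (s := vbasis fullv) (t := vbasis fullv)).
- by move=> a b aX bX; apply: memv_span; apply/allpairsP; exists (a, b).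
- by rewrite (span_basis (vbasisP _)) memvf.
- by rewrite (span_basis (vbasisP _)) memvf.
Qed.

(** Modulo A_D, f is a combination of the C_(T1,T2), and C_(S,T) C_(T1,T2) is [cell_form T T1] times
    C_(S,T2). If all these values vanished, C_(S,T) = C_(S,T) f would have only labels in D. *)
Lemma cell_form_neq0 (D : {pred Lam c}) (f : hom C k k) (l : Lam c) (T : cell_M k l) :
  lower D k k -> l \notin D ->
  (forall l', (l' < l)%O -> inh k l' -> l' \in D) ->
  cell_unit [predU1 l & D] f ->
  forall S : cell_M n l, exists T1 : cell_M k l, cell_form T T1 != 0.
Proof.
move=> lowD lD bD fU S.
have [//|none] := pselect (exists T1 : cell_M k l, cell_form T T1 != 0).
have form0 T1 : cell_form T T1 = 0.
  by apply/eqP/negPn/negP=> ne; apply: none; exists T1.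
have lowl : lower [predU1 l & D] k k.
  move=> l1 l2 lt; rewrite !inE => /predU1P[e|l2D] i1 i2.
    by rewrite bD ?orbT // -e.
  by rewrite (lowD _ _ lt l2D) ?orbT.
have Cf : comp (cell_C c S T) f = cell_C c S T.
  by apply: (cell_unit_compr lowl fU); rewrite mem_cell_span // inE eqxx.
have := cell_span_add fU.1; set g := \sum_(_ : _) _ => fgD.
have lowDn : lower D n k by exact: lower_right.
have CfD : cell_C c S T \in cell_span D n k.
  rewrite -Cf -[f](subrK g) compDr; apply: memvD; first exact: cell_span_compl.
  rewrite /g comp_sumr memv_suml // => T1 _; rewrite comp_sumr memv_suml // => T2 _.
  rewrite compZr memvZ //.
  have := @cell_mul_form _ _ _ c D _ _ _ _ S T T1 T2 (fun l' lt _ => bD l' lt).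
  by rewrite form0 scale0r subr0.
have := cell_crd_span S T lD CfD; rewrite cell_crdE !eqxx => /eqP.
by rewrite oner_eq0.
Qed.

(** Labels are treated along a chain. A nonzero value of the form recovers C_(S,U), up to labels
    already treated, from C_(S,T) C_(T1,U), which factors through k. *)
Lemma cell_span_factor : lower Lk n n -> (cell_span Lk n n <= factor_span)%VS.
Proof.
move=> lowL.
have low0 : lower (pred0 : {pred Lam c}) n n by [].
have s0 : {subset (pred0 : {pred Lam c}) <= Lk} by [].
have [|D lX lowD _ DL lXL lXD _ _ bD lowl IH|D [DF _ _ LD]] :=
    cell_chain (Q := fun D => (cell_span D n n <= factor_span)%VS) low0 lowL s0.
- by rewrite cell_span0 ?sub0v.
- apply: cell_span_addP => // S U; have /card_gt0P[T _] := lXL : inh k lX.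
  have lowk (D' : {pred Lam c}) : lower D' n n -> lower D' k k.
    by move=> low l' l lt l'D i _; apply: (low _ _ lt l'D); apply: kn.
  have bDk l' : (l' < lX)%O -> inh k l' -> l' \in D.
    by move=> lt i; apply: bD => //; apply: kn.
  have [f fU] := units_k (lowk _ lowl).
  have [T1 ne] := cell_form_neq0 T (lowk _ lowD) lXD bDk fU S.
  have := cell_mul_form S T T1 U bD => /(subvP IH) h.
  have -> : cell_C c S U = (cell_form T T1)^-1 *: (comp (cell_C c S T) (cell_C c T1 U) -
      (comp (cell_C c S T) (cell_C c T1 U) - cell_form T T1 *: cell_C c S U)).
    by rewrite opprB addrC subrK scalerA mulVf // scale1r.
  by apply: memvZ; rewrite memvB // mem_factor_span.
by apply: subv_trans DF; apply: cell_span_mono => l lL i _; apply: LD.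
Qed.

Lemma cell_unit_transfer D (e : hom C n n) :
  lower Lk n n -> cell_unit Lk e -> lower D n n -> {subset D <= Lk} ->
  exists f : hom C n n, cell_unit D f.
Proof.
move=> lowL eU lowD DL.
have lowDk : lower D k k.
  by move=> l' l lt lD i _; apply: (lowD _ _ lt lD); apply: kn.
have [f fU] := units_k lowDk.
(* The claim is linear in w, so products w = x y suffice; it is then applied to the identity e. *)
suff H w : w \in factor_span -> exists2 w' : hom C n n, w' \in cell_span D n n &
    forall z, z \in cell_span D n n -> comp z w' = comp z w.
  have [w' w'D w'E] := H e (subvP (cell_span_factor lowL) _ eU.1).
  exists w'; apply: cell_unit_right => // z zD; rewrite w'E //.
  have sub : (cell_span D n n <= cell_span Lk n n)%VS.
    by apply: cell_span_mono => l /DL.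
  exact: (eU.2 _ (subvP sub _ zD)).2.
move: w; rewrite /factor_span.
apply: span_rect => [|a x y [x' xD xE] [y' yD yE]|w].
- by exists 0; rewrite ?mem0v.
- exists (a *: x' + y'); first by rewrite memvD ?memvZ.
  by move=> z zD; rewrite !compDr !compZr xE ?yE.
case/allpairsP=> [[x y] [_ _ ->]] /=.
(* z x is a morphism from n to k with labels in D only, and f is a right identity on those. *)
exists (comp (comp x f) y).
  apply: cell_span_compr => //; apply: cell_span_compl; last exact: fU.1.
  exact: lower_right.
move=> z zD; rewrite !compA; congr comp.
apply: (cell_unit_compr lowDk fU); apply: cell_span_compr zD.
exact: lower_left.
Qed.

End UnitTransfer.

(** * Semisimplicity from the existence of identities *)

Section SemisimpleFromUnits.
Variables (K : fieldType) (Ob : Type) (C : lincat K Ob) (c : cellular C) (n : Ob).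
Implicit Types (D : {pred Lam c}) (l : Lam c).

Section Layer.
Variables (D : {pred Lam c}) (l : Lam c) (e f : hom C n n).
Hypotheses (lowD : lower D n n) (lowl : lower [predU1 l & D] n n).
Hypothesis bD : forall l', (l' < l)%O -> inh n l' -> inh n l' -> l' \in D.
Hypotheses (eU : cell_unit D e) (fU : cell_unit [predU1 l & D] f).

Let e' := idm n - e.

Let De' x : x \in cell_span D n n -> comp x e' = 0.
Proof. by move=> xD; rewrite compBr compm1 (eU.2 _ xD).2 subrr. Qed.

Definition layer_column (T : cell_M n l) : {vspace hom C n n} :=
  <<[seq comp (cell_C c X T) e' | X <- enum (cell_M n l)]>>%VS.

Lemma mem_layer_column (S T : cell_M n l) : comp (cell_C c S T) e' \in layer_column T.
Proof. by apply/memv_span/map_f; rewrite mem_enum. Qed.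

(** The error term of (C3) lies in A_D, which right multiplication by 1 - e kills. *)
Lemma layer_column_submodule T :
  submodule (layer_column T : {vspace regular (endalg C n)}).
Proof.
move=> a x; rewrite -[mact a x]/(comp a x) {1}/layer_column; move: x.
apply: span_rect => [|k x y xV yV|x].
- by rewrite comp0r mem0v.
- by rewrite compDr compZr memvD ?memvZ.
case/mapP=> S _ ->; rewrite compA.
have := cell_mul_span a S T bD; set g := \sum_(_ : _) _ => gD.
rewrite -[comp a _](subrK g) compDl De' // add0r comp_suml memv_suml // => S' _.
by rewrite compZl memvZ ?mem_layer_column.
Qed.

(** A nonzero v in a submodule W of the column satisfies f v = v and A_D v = 0, so some C_(S1,T1) v
    is nonzero. Since C_(S,T1) v is a multiple of C_(S,T) (1 - e) with a factor independent of S,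
    this factor is nonzero and W contains every generator. *)
Lemma layer_column_simple T : layer_column T != 0%VS ->
  simple_submodule (layer_column T : {vspace regular (endalg C n)}).
Proof.
move=> V0; split=> //; first exact: layer_column_submodule.
move=> W hW WV; have [->|W0] := eqVneq W 0%VS; [by left | right].
pose v : hom C n n := vpick W.
have v0 : v != 0 by rewrite vpick0.
have vW : v \in W by apply: memv_pick.
have := subvP WV _ vW; rewrite /layer_column => vV.
have Dv z : z \in cell_span D n n -> comp z v = 0.
  move=> zD; move: (v) vV; apply: span_rect => [|k x y x0 y0|x].
  - exact: comp0r.
  - by rewrite compDr compZr x0 y0 scaler0 addr0.
  by case/mapP=> S _ ->; rewrite compA De' // cell_span_compr.
have fv : comp f v = v.
  move: (v) vV; apply: span_rect => [|k x y x0 y0|x].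
  - exact: comp0r.
  - by rewrite compDr compZr x0 y0.
  case/mapP=> S _ ->; rewrite compA (fU.2 _ _).1 // mem_cell_span //.
  by rewrite inE eqxx.
have [[S1 [T1 CvN0]]|none] :=
    pselect (exists S1 T1 : cell_M n l, comp (cell_C c S1 T1) v != 0); last first.
  have := cell_span_add fU.1; set g := \sum_(_ : _) _ => gD.
  case/eqP: v0; rewrite -fv -[f](subrK g) compDl Dv // add0r.
  rewrite /g comp_suml big1 // => S _; rewrite comp_suml big1 // => T2 _.
  rewrite compZl; apply/eqP; rewrite scaler_eq0; apply/orP; right.
  by apply/negPn/negP=> ne; apply: none; exists S, T2.
have [kap kapE] : exists kap : K, forall S : cell_M n l,
    comp (cell_C c S T1) v = kap *: comp (cell_C c S T) e'.
  move: (v) vV; apply: (span_rect (P := fun w => exists kap : K, forall S : cell_M n l,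
      comp (cell_C c S T1) w = kap *: comp (cell_C c S T) e')) =>
    [|k x y [kx kxE] [ky kyE]|x].
  - by exists 0 => S; rewrite comp0r scale0r.
  - by exists (k * kx + ky) => S; rewrite compDr compZr kxE kyE scalerDl scalerA.
  case/mapP=> S2 _ ->; exists (cell_form T1 S2) => S.
  have := cell_mul_form S T1 S2 T bD; set g := _ *: _ => gD.
  by rewrite compA -[comp (cell_C c S T1) _](subrK g) compDl De' // add0r compZl.
have kap0 : kap != 0.
  by apply: contra CvN0 => /eqP k0; rewrite kapE k0 scale0r.
apply/eqP; rewrite eqEsubv WV; apply/span_subvP=> x /mapP[S _ ->].
rewrite -[comp _ _]scale1r -(mulVf kap0) -scalerA -kapE; apply: memvZ.
exact: (hW (cell_C c S T1)).
Qed.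

End Layer.

Lemma semisimple_of_units :
  (forall D, lower D n n -> exists e : hom C n n, cell_unit D e) ->
  semisimple_algebra (endalg C n).
Proof.
move=> units; have low0 : lower (pred0 : {pred Lam c}) n n by [].
have low1 : lower (predT : {pred Lam c}) n n by [].
have s0 : {subset (pred0 : {pred Lam c}) <= (predT : {pred Lam c})} by [].
have [|D l lowD _ _ _ lD _ _ bD lowl [s [simp sD]]|D [[s [simp sD]] _ _ DT]] :=
    cell_chain (Q := fun D => exists s : seq {vspace regular (endalg C n)},
      (forall S, S \in s -> simple_submodule S) /\
      (cell_span D n n <= \sum_(S <- s) S)%VS) low0 low1 s0.
- by exists [::]; rewrite cell_span0 ?sub0v.
- have [e eU] := units D lowD; have [f fU] := units _ lowl.
  (* Zero columns are discarded, a simple submodule being nonzero. *)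
  pose t : seq {vspace regular (endalg C n)} :=
    [seq V <- [seq layer_column e T | T <- enum (cell_M n l)] | V != 0%VS].
  exists (s ++ t); split.
    move=> V; rewrite mem_cat => /orP[/simp //|].
    rewrite mem_filter => /andP[V0 /mapP[T _ VE]]; rewrite VE.
    by apply: (layer_column_simple lowD bD eU fU); rewrite -VE.
  rewrite big_cat /=; apply: cell_span_addP => [|S T].
    exact/(subv_trans sD)/addvSl.
  (* The first summand lies in A_D, the second in the column of T. *)
  have -> : cell_C c S T = comp (cell_C c S T) e + comp (cell_C c S T) (idm n - e).
    by rewrite -compDr addrC subrK compm1.
  apply: memv_add.
    by apply: (subvP sD); apply: cell_span_compl lowD eU.1.
  have := mem_layer_column e S T; have [V0|V0] := eqVneq (layer_column e T) 0%VS.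
    by rewrite V0 memv0 => /eqP->; rewrite mem0v.
  apply/subvP; rewrite [X in (_ <= X)%VS](big_rem
    (layer_column e T : {vspace regular (endalg C n)})) /=; first exact: addvSl.
  by rewrite mem_filter V0 map_f // mem_enum.
apply: (semisimple_module_sum simp); apply/eqP; rewrite eqEsubv subvf.
by rewrite -(cell_span_full (D := D)) // => l i _; apply: DT.
Qed.

End SemisimpleFromUnits.

(** * Cellular tower categories *)

Section LabelSets.
Variables (K : fieldType) (A : cellular_tower K).
Let C := tower_cat A.
Let c := tower_cell A.

Lemma Delta_filtration_filtered n (M : amod (endalg C n)) (s : seq (Lam c))
    (P : Lam c -> Prop) :
  Delta_filtration M s -> (forall l, l \in s -> P l) ->
  filtered (Delta n) P (0%VS : {vspace M}) fullv.
Proof.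
move=> [F [F0 Fs hF _ step]] sP; rewrite -Fs.
suff H i : (i <= size s)%N -> filtered (Delta n) P (0%VS : {vspace M}) (F i) by exact: H.
elim: i => [|i IH] lti; first by rewrite F0; apply: filtered_refl.
(* The default label for [nth] is the head of s, which is nonempty as i < size s. *)
case: s sP Fs hF step lti IH => // l0 s sP _ hF step lti IH.
have [FF iso] := step l0 i lti.
apply: (filtered_step (IH (ltnW lti)) _ FF _ iso); first exact: hF.
exact/sP/mem_nth.
Qed.

(* Hom(n, n+2) = 0 forces A_(n+1) = 0 by (A2), hence A_n = 0. *)
Lemma LamZ_saturated n :
  saturated (LamZ n%:Z : {pred Lam c}) (LamZ n.+2%:Z).
Proof.
have [nz|z] := pselect (exists f : hom C n n.+2, f != 0).
  by apply: (her_saturated (tower_her A)) nz; rewrite -addn2 leq_addr.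
have hom0 (x : hom C n.+2 n) : x = 0.
  rewrite -[x](starK c); apply/eqP; apply: contrapT => ne; apply: z.
  exists (star c x); apply/negP=> /eqP x0; apply: ne.
  by rewrite x0 star0.
have [phi [[psi _ psiK] _]] := tower_A2 A n.
have one0 : aone (endalg C n.+1) = 0 by rewrite -[LHS]psiK (hom0 (psi _)) linear0.
have idm0 : idm n = 0 :> hom C n n.
  by apply: (@tower_A1 _ A n); rewrite linear0 -one0; apply: alghom1.
have none l : l \notin (LamZ n%:Z : {pred Lam c}).
  apply/negP=> /card_gt0P[S _]; have := cell_crdE (c := c) S S S S.
  rewrite -[cell_C c S S]comp1m idm0 comp0l linear0 !eqxx => /eqP.
  by rewrite eq_sym oner_eq0.
by split=> [l | l m _]; rewrite (negPf (none _)).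
Qed.

Lemma LamZ_sub2 n : {subset LamZ (n%:Z - 2) <= (LamZ n%:Z : {pred Lam c})}.
Proof.
(* For n < 2 the index n - 2 is negative and the label set is empty. *)
case: n => [|[|n]] l //; have -> : n.+2%:Z - 2 = n%:Z by rewrite -addn2 PoszD addrK.
exact: (LamZ_saturated n).1.
Qed.

Lemma LamZ_lower2 n : lower (LamZ (n%:Z - 2) : {pred Lam c}) n n.
Proof.
case: n => [|[|n]] // l' l lt; have -> : n.+2%:Z - 2 = n%:Z by rewrite -addn2 PoszD addrK.
by move=> lD i _; apply: (LamZ_saturated n).2 lt lD i.
Qed.

Lemma LamZ_sub4 n : {subset LamZ (n%:Z - 4) <= (LamZ (n%:Z - 2) : {pred Lam c})}.
Proof.
case: n => [|[|n]] l //.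
have -> : n.+2%:Z - 2 = n%:Z by rewrite -addn2 PoszD addrK.
have -> : n.+2%:Z - 4 = n%:Z - 2 by rewrite -addn2 PoszD -addrA.
exact: LamZ_sub2.
Qed.

Lemma LamZ_lower4 n : lower (LamZ (n%:Z - 4) : {pred Lam c}) n n.
Proof.
move=> l' l lt lD i _; have lD2 := LamZ_sub4 lD.
(* Saturation is used twice: in Lambda_n, to place l' in Lambda_(n-2), then in Lambda_(n-2). *)
have l'D2 := @LamZ_lower2 n l' l lt lD2 i i.
case: n lD {lD2 i} l'D2 => [|[|n]] //.
have -> : n.+2%:Z - 2 = n%:Z by rewrite -addn2 PoszD addrK.
have -> : n.+2%:Z - 4 = n%:Z - 2 by rewrite -addn2 PoszD -addrA.
move=> lD i; exact: (@LamZ_lower2 n l' l lt lD i i).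
Qed.

End LabelSets.

(** * Identities in a cellular tower category *)

Section Tower.
Variables (K : fieldType) (A : cellular_tower K).
Let C := tower_cat A.
Let c := tower_cell A.
Hypothesis hExt : forall (n : nat) (l m : Lam c),
     l \in LamZ n%:Z -> l \notin LamZ (n%:Z - 2) ->
     m \in LamZ n%:Z -> m \notin LamZ (n%:Z - 4) ->
     Ext1_eq0 (Delta n l) (Delta n m).

Let I n : {pred Lam c} := LamZ (n%:Z - 2).
Let I' n : {pred Lam c} := LamZ (n%:Z - 4).

(** [filtered_kernel] for 1 in A_n / A_W, with J and T both equal to A_D. Sections labelled outside
    D are killed by A_D; their labels avoid Lambda_(n-2) and all labels outside W avoid
    Lambda_(n-4), so the hypothesis on Ext^1 applies. *)
Lemma split_quotient n (W D : {pred Lam c}) :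
  lower W n n -> lower D n n ->
  {subset I' n <= W} -> {subset W <= D} -> {subset I n <= D} ->
  exists2 y : hom C n n, idm n - y \in cell_span D n n &
    forall a, a \in cell_span D n n -> comp a y \in cell_span W n n.
Proof.
move=> lowW lowD I'W WD ID; have low1 : lower (predT : {pred Lam c}) n n by [].
have DT : {subset D <= (predT : {pred Lam c})} by [].
pose P (l : Lam c) := inh n l /\ l \notin W; pose Q (l : Lam c) := inh n l /\ l \notin D.
have fW : filtered (M := hom_mod C n n) (Delta n) P (cell_span W n n) (cell_span D n n).
  apply: (filtered_weaken _ (filtered_cell_span lowW lowD WD)) => l [_ lW i _].
  by [].
have fD : filtered (M := hom_mod C n n) (Delta n) Q (cell_span D n n)
    (cell_span (predT : {pred Lam c}) n n).
  apply: (filtered_weaken _ (filtered_cell_span lowD low1 DT)) => l [_ lD i _].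
  by [].
have oneT : idm n \in cell_span (predT : {pred Lam c}) n n.
  by rewrite cell_span_full ?memvf.
have [|||y [_ y1 yW]] := filtered_kernel
  (J := fun a : endalg C n => a \in cell_span D n n)
  (cell_span_submodule lowW) fW (subvv _) fD _ _ _ oneT.
- by move=> l [i lD]; split=> //; apply: contra lD => /WD.
- by move=> a x aD; apply: cell_span_compr.
- move=> l [i lD]; left; split=> [m [j mW] | a z aD].
    by apply: hExt => //; [apply: contra lD => /ID | apply: contra mW => /I'W].
  exact: (cell_span_kill z lowD aD lD).
by exists y.
Qed.

(** The splitting gives y with x (1 - y) congruent to x modulo A_I' for x in A_I. Cell modules need
    left multiplication, whence the involution in the witness. *)
Lemma middle_unit n : exists2 e : hom C n n, e \in cell_span (I n) n n &
  forall l, l \in I n -> l \notin I' n ->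
    forall z : Delta n l, mact (e : endalg C n) z = z.
Proof.
have low2 := @LamZ_lower2 K A n; have low4 := @LamZ_lower4 K A n.
have [y y1 yI'] :=
  split_quotient low4 low2 (fun _ h => h) (@LamZ_sub4 K A n) (fun _ h => h).
exists (star c (idm n - y)); first exact: cell_span_star.
move=> l lI lI' z; apply/ffunP=> Y; rewrite ffunE.
have rE (X S : cell_M n l) : cell_r c (star c (idm n - y)) X S = (X == S)%:R :> K.
  rewrite (cell_r_crd _ _ S) -[comp _ _](starK c) star_comp starK cell_star.
  rewrite compBr compm1 starB cell_star linearB /= cell_crdE eqxx andbT eq_sym.
  rewrite (cell_crd_span _ _ lI') ?subr0 //.
  exact/cell_span_star/yI'/mem_cell_span.
rewrite (bigD1 Y) //= rE eqxx mul1r big1 ?addr0 // => X ne.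
by rewrite rE eq_sym (negPf ne) mul0r.
Qed.

Lemma unit_step n (eps : hom C n n) :
  cell_unit (I n : {pred Lam c}) eps ->
  exists e : hom C n.+1 n.+1, cell_unit (I n.+1 : {pred Lam c}) e.
Proof.
move=> epsU; pose inc := tower_incl A.
have N2 : n.+1%:Z - 2 = n%:Z - 1 by rewrite -addn1 PoszD -addrA.
have N4 : n.+1%:Z - 4 = n%:Z - 3 by rewrite -addn1 PoszD -addrA.
have lowI : lower (I n.+1 : {pred Lam c}) n.+1 n.+1 := @LamZ_lower2 K A n.+1.
have lown : lower (I n : {pred Lam c}) n n := @LamZ_lower2 K A n.
have low1 m p : lower (predT : {pred Lam c}) m p by [].
have subT (D : {pred Lam c}) : {subset D <= (predT : {pred Lam c})} by [].
have [e0 e0I e0E] := middle_unit n.+1.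
(* eps kills the restrictions of the sections of A_(n+1) / I, by (A3). *)
have incI : inc n eps \in cell_span (I n.+1) n.+1 n.+1.
  have fI := filtered_cell_span lowI (low1 n.+1 n.+1) (subT _).
  pose Q (l : Lam c) := l \notin I n.
  have fR : filtered (M := Res (inc n) (hom_mod C n.+1 n.+1)) (Delta n) Q
      (cell_span (I n.+1) n.+1 n.+1) (cell_span (predT : {pred Lam c}) n.+1 n.+1).
    apply: filtered_comp (cell_span_submodule lowI) _ fI => l [_ lI iN _].
    have [|s [fs sP]] := @tower_A3 K A n.+1 n l (leqnn _) _ iN lI; first by rewrite subnn.
    apply: (Delta_filtration_filtered fs) => l' /sP /andP[].
    have -> : n.+1%:Z - 1 = n%:Z by rewrite -addn1 PoszD addrK.
    have -> : n.+1%:Z - 3 = n%:Z - 2 by rewrite -addn1 PoszD -addrA.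
    by case/orP=> /andP[_ // /negPf->].
  have hI : submodule (cell_span (I n.+1) n.+1 n.+1
      : {vspace Res (inc n) (hom_mod C n.+1 n.+1)}).
    by move=> a x; apply: (cell_span_compl (inc n a) lowI).
  have ee x : mact (eps : endalg C n) (mact (eps : endalg C n) x) =
      mact (eps : endalg C n) x :> Res (inc n) (hom_mod C n.+1 n.+1).
    by rewrite -mactM /= (epsU.2 _ epsU.1).1.
  have one1 : idm n.+1 \in cell_span (predT : {pred Lam c}) n.+1 n.+1.
    by rewrite cell_span_full ?memvf.
  have := idempotent_filtered (M := Res (inc n) (hom_mod C n.+1 n.+1)) hI fR ee _ one1.
  rewrite -[mact _ _]/(comp (inc n eps) (idm n.+1)) compm1; apply=> l lQ z.
  exact: cell_span_kill lown epsU.1 lQ.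
have [phi [phi_bij phiE]] := tower_A2 A n.
have [psi psiK phiK] := phi_bij.
(* phi identifies X with the regular module of A_(n+1). It carries W onto the left ideal A_(n+1) eps
   and T onto the ideal A_I of A_(n+1). *)
pose X := Res (inc n.+1) (hom_mod C n.+2 n).
pose W := cell_span (I n) n.+2 n.
pose T : {vspace X} := (phi @^-1: cell_span (I n.+1) n.+1 n.+1)%VS.
have phiL (a : endalg C n.+1) x : phi (comp (inc n.+1 a) x) = comp a (phi x).
  have := phiE a x (idm n); rewrite compm1 => ->.
  by rewrite [inc n _]alghom1 /= compm1.
have phiR x (b : endalg C n) : phi (comp x b) = comp (phi x) (inc n b).
  have := phiE (idm n.+1) x b; rewrite [inc n.+1 _]alghom1 comp1m => ->.
  by rewrite /= comp1m.
have Weps x : x \in W -> comp x eps = x by apply: cell_unit_compr.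
have incee : comp (inc n eps : hom C n.+1 n.+1) (inc n eps) = inc n eps.
  by rewrite -[LHS](alghomM (inc n)) /= (epsU.2 _ epsU.1).1.
have WT : (W <= T)%VS.
  apply/subvP=> x xW; rewrite -memv_preim -(Weps x xW) phiR.
  exact: cell_span_compl.
have lowX : lower (I n : {pred Lam c}) n.+2 n by exact: lower_right.
pose P (l : Lam c) := l \in LamZ n.+1%:Z /\ l \notin I' n.+1.
(* (A3) at level n+2 with m = n: the labels avoid Lambda_(n-3) or Lambda_(n-1), and the latter
   contains the former. *)
have fX : filtered (M := X) (Delta n.+1) P W fullv.
  have := filtered_cell_span lowX (low1 n.+2 n) (subT _).
  rewrite [X in filtered _ _ _ X](cell_span_full (D := predT)) // => fX.
  apply: filtered_comp (cell_span_submodule lowX) _ fX => l [_ lI _ iN].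
  have [||s [fs sP]] := @tower_A3 K A n n.+1 l _ _ iN lI; first exact/leqW/leqnSn.
    by rewrite subSn ?leqnSn // subSnn.
  apply: (Delta_filtration_filtered fs) => l' /sP /andP[h l'N]; split=> //.
  rewrite /I' N4; case/orP: h => /andP[_ //]; apply: contra.
  rewrite -N4 -N2; exact: (@LamZ_sub4 K A n.+1).
have hW : submodule (W : {vspace X}).
  by move=> a x; apply: (cell_span_compl (inc n.+1 a) lowX).
pose one := psi (aone (endalg C n.+1)).
have oneX : (one : X) \in (fullv : {vspace X}) by exact: memvf.
have [|a x|l [lN lI']|y [_ y1 yW]] := filtered_kernel (M := X) (P := P)
    (J := fun a : endalg C n.+1 => a \in cell_span (I n.+1) n.+1 n.+1)
    hW (filtered_refl _ _ _) WT fX _ _ _ oneX.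
- by [].
- move=> aI; rewrite /T -memv_preim [phi _]phiL; exact: cell_span_compr.
- have [lI|lI] := boolP (l \in I n.+1).
    by right; exists e0 => // z; apply: e0E.
  left; split=> [m [mN mI'] | a z aI]; first exact: hExt.
  exact: cell_span_kill lowI aI lI.
move: y1; rewrite -memv_preim linearB /= /one phiK => y1.
(* Both phi y - 1 and eps lie in A_I, so h is congruent to 1. For a in A_I, a y lies in W, on which
   eps is a right identity, so a h = 0. *)
set h := comp (phi y : hom C n.+1 n.+1) (idm n.+1 - inc n eps).
have hE : idm n.+1 - h = (idm n.+1 - phi y) + comp (phi y : hom C n.+1 n.+1) (inc n eps).
  by rewrite /h compBr compm1 opprB addrA addrAC.
exists (idm n.+1 - h); apply: cell_unit_complement => [|a aI].
  by rewrite hE memvD // cell_span_compl.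
rewrite /h compA -phiL compBr compm1 -phiR Weps ?subrr //; exact: yW.
Qed.

Lemma cell_unit_LamZ n : exists e : hom C n n, cell_unit (I n : {pred Lam c}) e.
Proof.
elim: n => [|n [eps /unit_step //]].
exists 0; rewrite /cell_unit cell_span0 // mem0v; split=> // x.
by rewrite memv0 => /eqP->; rewrite comp0r.
Qed.

(** The splitting gives A_D y inside A_I, and the factor 1 - e kills what is left, so h = y (1 - e)
    is annihilated by A_D. *)
Lemma cell_unit_above n (D : {pred Lam c}) : lower D n n -> {subset I n <= D} ->
  exists e : hom C n n, cell_unit D e.
Proof.
move=> lowD ID; have lowI := @LamZ_lower2 K A n.
have [e eU] := cell_unit_LamZ n.
have [y y1 yI] := split_quotient lowI lowD (@LamZ_sub4 K A n) ID ID.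
pose h := comp y (idm n - e).
exists (idm n - h); apply: cell_unit_complement => [|a aD].
  have -> : idm n - h = (idm n - y) + comp y e.
    by rewrite /h compBr compm1 opprB addrA addrAC.
  rewrite memvD //; apply: (subvP (cell_span_mono _)) (cell_span_compl y lowI eU.1).
  by move=> l /ID.
by rewrite /h compA compBr compm1 (eU.2 _ (yI _ aD)).2 subrr.
Qed.

(** [cell_unit_predUI] with L = I reduces D to its union with I, which contains I, and its
    intersection with I, handled by transfer from A_(n-2) and strong induction. *)
Lemma cell_unit_exists n (D : {pred Lam c}) :
  lower D n n -> exists e : hom C n n, cell_unit D e.
Proof.
elim/ltn_ind: n D => n IH D lowD.
have lowI : lower (I n : {pred Lam c}) n n := @LamZ_lower2 K A n.
have [e eU] := cell_unit_LamZ n.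
have [a aU] : exists a : hom C n n, cell_unit [predU D & I n] a.
  apply: cell_unit_above => [l' l lt|l lI]; last by rewrite inE /= lI orbT.
  rewrite !inE => /orP[lD|lI] i _.
    by rewrite (lowD _ _ lt lD i i).
  by rewrite (lowI _ _ lt lI i i) orbT.
have lowDI : lower [predI D & I n] n n.
  move=> l' l lt; rewrite !inE => /andP[lD lI] i _.
  by rewrite (lowD _ _ lt lD i i) [_ \in I n](lowI _ _ lt lI i i).
suff [b bU] : exists b : hom C n n, cell_unit [predI D & I n] b.
  exact: cell_unit_predUI lowD lowI eU aU bU.
have DI l : l \in [predI D & I n] -> l \in I n by case/andP.
move: {D lowD aU a} [predI D & I n] lowDI DI => E lowE EI.
have zero_unit : (forall l, l \notin E) -> exists b : hom C n n, cell_unit E b.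
  move=> E0; exists 0; rewrite /cell_unit cell_span0 // mem0v; split=> // x.
  by rewrite memv0 => /eqP->; rewrite comp0r.
(* For n < 2 the set I is empty, so E is empty and 0 is the identity. *)
case: n IH e eU lowI E lowE EI zero_unit => [|[|k]] IH e eU lowI E lowE EI zero_unit.
- by apply: zero_unit => l; apply/negP=> /EI.
- by apply: zero_unit => l; apply/negP=> /EI.
have Ik : I k.+2 = (fun l : Lam c => inh k l) by rewrite /I -addn2 PoszD addrK.
rewrite Ik in eU lowI EI.
apply: (cell_unit_transfer _ _ lowI eU lowE EI) => [l | D lowD].
  exact: (LamZ_saturated A k).1.
by apply: IH lowD; rewrite ltnS leqnSn.
Qed.

End Tower.

Theorem theorem1p1 (K : fieldType) (A : cellular_tower K)
  (hExt : forall (n : nat) (l m : Lam (tower_cell A)),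
     l \in LamZ n%:Z -> l \notin LamZ (n%:Z - 2) ->
     m \in LamZ n%:Z -> m \notin LamZ (n%:Z - 4) ->
     Ext1_eq0 (Delta n l) (Delta n m)) :
  forall n : nat, semisimple_algebra (endalg (tower_cat A) n).
Proof.
move=> n; apply: (semisimple_of_units (c := tower_cell A)) => D.
exact: cell_unit_exists.
Qed.
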